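(* Let $(f,e,v)\in\mathbb N^3$ satisfy $f\ge \frac v2+2$, $v\ge \frac f2+2$ and $e=f+v-2$, and suppose $(f,e,v)\neq(4,6,4)$. Then there exist a convex polyhedron $\mathcal P$ with $f$ faces, $e$ edges and $v$ vertices and a point $O\in\operatorname{int}\mathcal P$ such that $(\mathcal P,O)$ is mono-monostatic.
   Context: The vectors $(f,e,v)$ satisfying the three stated conditions are exactly the face vectors (numbers of faces, edges, vertices) of nondegenerate convex polyhedra. For $O\in\operatorname{int}\mathcal P$, $(\mathcal P,O)$ is in equilibrium on a face, edge or vertex $X$ if there exists $Q$ in the relative interior of $X$ (a vertex being its own relative interior) such that the plane perpendicular to $[O,Q]$ at $Q$ supports $\mathcal P$; equilibria on faces are stable, on vertices unstable. $(\mathcal P,O)$ is mono-monostatic if it has exactly one stable equilibrium and exactly one unstable equilibrium. *)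

(* Defs.v *)
From mathcomp Require Import all_boot all_order all_algebra.
From mathcomp Require Import reals.
Set Implicit Arguments. Unset Strict Implicit. Unset Printing Implicit Defensive.
Import Order.TTheory GRing.Theory Num.Theory.
Local Open Scope ring_scope.

Section Polyhedra.
Variable R : realType.

Definition point := 'rV[R]_3.

Definition dot (u w : point) : R := \sum_(i < 3) u ord0 i * w ord0 i.

Definition conv_hull (S : seq point) (x : point) : Prop :=
  exists w : 'I_(size S) -> R,
    (forall i, 0 <= w i) /\ \sum_(i < size S) w i = 1 /\
    x = \sum_(i < size S) w i *: nth 0 S i.

Definition interior (P : point -> Prop) (O : point) : Prop :=
  exists eps : R, 0 < eps /\
    forall x, dot (x - O) (x - O) < eps ^+ 2 -> P x.

Definition convex_polyhedron (P : point -> Prop) : Prop :=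
  (exists S : seq point, forall x, P x <-> conv_hull S x) /\
  (exists O, interior P O).

Definition supports (P : point -> Prop) (n : point) (c : R) : Prop :=
  n != 0 /\
  ((forall x, P x -> dot n x <= c) \/ (forall x, P x -> c <= dot n x)) /\
  (exists x, P x /\ dot n x = c).

Definition is_face (P X : point -> Prop) : Prop :=
  exists (n : point) (c : R), supports P n c /\
    forall x, X x <-> (P x /\ dot n x = c).

Definition has_aff_indep (X : point -> Prop) (k : nat) : Prop :=
  exists p : 'I_k.+1 -> point, (forall i, X (p i)) /\
    \rank (\matrix_(i < k, j < 3) (p (lift ord0 i) ord0 j - p ord0 ord0 j)) = k.

Definition aff_dim (X : point -> Prop) (k : nat) : Prop :=
  has_aff_indep X k /\ ~ has_aff_indep X k.+1.

Definition kface (P X : point -> Prop) (k : nat) : Prop :=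
  is_face P X /\ aff_dim X k.

Definition same_set (X Y : point -> Prop) : Prop := forall x, X x <-> Y x.

Definition num_kfaces (P : point -> Prop) (k m : nat) : Prop :=
  exists F : 'I_m -> (point -> Prop),
    (forall i, kface P (F i) k) /\
    (forall i j, same_set (F i) (F j) -> i = j) /\
    (forall X, kface P X k -> exists i, same_set X (F i)).

Definition aff_hull (X : point -> Prop) (y : point) : Prop :=
  exists (m : nat) (p : 'I_m -> point) (w : 'I_m -> R),
    (forall i, X (p i)) /\ \sum_(i < m) w i = 1 /\ y = \sum_(i < m) w i *: p i.

Definition relint (X : point -> Prop) (Q : point) : Prop :=
  X Q /\ exists eps : R, 0 < eps /\
    forall y, aff_hull X y -> dot (y - Q) (y - Q) < eps ^+ 2 -> X y.

Definition equilibrium_on (P : point -> Prop) (O : point) (X : point -> Prop) : Prop :=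
  exists Q, relint X Q /\ supports P (Q - O) (dot (Q - O) Q).

Definition unique_equilibrium_kface (P : point -> Prop) (O : point) (k : nat) : Prop :=
  exists X, kface P X k /\ equilibrium_on P O X /\
    forall Y, kface P Y k -> equilibrium_on P O Y -> same_set Y X.

(* mono-monostatic: exactly one stable (face, k=2) and exactly one unstable
   (vertex, k=0) equilibrium *)
Definition mono_monostatic (P : point -> Prop) (O : point) : Prop :=
  unique_equilibrium_kface P O 2 /\ unique_equilibrium_kface P O 0.

End Polyhedra.

(* Main.v *)
Require Import Defs.
From mathcomp Require Import all_boot all_order all_algebra.
From mathcomp Require Import reals.
From mathcomp Require Import ring lra zify.
Set Implicit Arguments. Unset Strict Implicit. Unset Printing Implicit Defensive.
Import Order.TTheory GRing.Theory Num.Theory.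
Local Open Scope ring_scope.

(** Take the reference point to be the origin and describe a polyhedron by its
    vertices [V] and by the normals [N] of its facets, normalized as [n . x <= 1].
    Polarity exchanges [V] and [N]; it also exchanges the two kinds of equilibria:
    the vertex [y] is in equilibrium iff [y . w <= y . y] for all vertices [w], and
    the facet [n] is in equilibrium iff [m . n < n . n] for all other normals [m].
    Hence one may assume [f <= v].

    Cut off a vertex [q] of degree three that is not an equilibrium and lies on a
    facet [n0] that is not one either. If the cutting plane is almost parallel to
    [n0] and the new vertices are close to [q], no equilibrium appears or
    disappears, and a new vertex can play the role of [q] again. This turns [(f, v)]
    into [(f + 1, v + 2)], or into [(f + 1, v + 1)] if the cutting plane passes
    through a neighbor of [q]. All pairs with [f <= v] are reached from [(5, 5)] and
    [(5, 6)], for which explicit polyhedra, themselves cut tetrahedra, are given. *)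

(** * Linear algebra *)

(** The cut is a perturbation argument. As the cut gets finer, the new vertices tend to [q] and the
    new normal tends to [n0], so they inherit strict witnesses against being in equilibrium; this is
    why neither [q] nor [n0] may be an equilibrium. A vertex whose witness was the lost [q] takes a
    new vertex near [q] instead. Two starting pairs are needed because neither cut lowers 2f - v:
    this number is 4 on the boundary of the range and already 5 at (5, 5). Euler's formula is not
    derived from topology. Edges are pairs of vertices on two common facets, a count that polarity
    preserves; e = f + v - 2 is checked at the start and carried through every cut. Dimensions of
    faces are likewise read off from incidences: a functional in the hull of the normals is a facet
    normal, or its face lies in two facets. *)

Section Dot.
Variable R : realType.
Implicit Types (x y z : point R) (a t : R).

Lemma dotE x y : dot x y = x 0 0 * y 0 0 + x 0 1 * y 0 1 + x 0 2%:R * y 0 2%:R.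
Proof.
rewrite /dot !big_ord_recl big_ord0 addr0 addrA.
by congr (x _ _ * y _ _ + x _ _ * y _ _ + x _ _ * y _ _); apply: val_inj.
Qed.

Lemma dotC x y : dot x y = dot y x.
Proof. by apply: eq_bigr => i _; rewrite mulrC. Qed.

Lemma dotDr x y z : dot x (y + z) = dot x y + dot x z.
Proof. by rewrite -big_split; apply: eq_bigr => i _; rewrite !mxE mulrDr. Qed.

Lemma dotZr a x y : dot x (a *: y) = a * dot x y.
Proof. by rewrite mulr_sumr; apply: eq_bigr => i _; rewrite !mxE mulrCA. Qed.

Lemma dotNr x y : dot x (- y) = - dot x y.
Proof. by rewrite -scaleN1r dotZr mulN1r. Qed.

Lemma dot0r x : dot x 0 = 0.
Proof. by rewrite -(scale0r 0) dotZr mul0r. Qed.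

Lemma dotDl x y z : dot (y + z) x = dot y x + dot z x.
Proof. by rewrite dotC dotDr !(dotC x). Qed.

Lemma dotZl a x y : dot (a *: y) x = a * dot y x.
Proof. by rewrite dotC dotZr dotC. Qed.

Lemma dotNl x y : dot (- y) x = - dot y x.
Proof. by rewrite dotC dotNr dotC. Qed.

Lemma dot0l x : dot 0 x = 0.
Proof. by rewrite dotC dot0r. Qed.

Lemma dot_sumr (I : Type) (r : seq I) (P : pred I) (F : I -> point R) x :
  dot x (\sum_(i <- r | P i) F i) = \sum_(i <- r | P i) dot x (F i).
Proof. by apply: (big_morph _ (dotDr x) (dot0r x)). Qed.

Lemma dot_suml (I : Type) (r : seq I) (P : pred I) (F : I -> point R) x :
  dot (\sum_(i <- r | P i) F i) x = \sum_(i <- r | P i) dot (F i) x.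
Proof. by rewrite dotC dot_sumr; apply: eq_bigr => i _; rewrite dotC. Qed.

Definition dotlin := (dotDr, dotDl, dotNr, dotNl, dotZr, dotZl).

Lemma dot_mx x y : dot x y = (x *m y^T) 0 0.
Proof. by rewrite mxE; apply: eq_bigr => i _; rewrite !mxE. Qed.

Lemma dot_ge0 x : 0 <= dot x x.
Proof. by apply: sumr_ge0 => i _; rewrite -expr2 sqr_ge0. Qed.

Lemma dot_eq0 x : (dot x x == 0) = (x == 0).
Proof.
apply/idP/eqP => [|->]; last by rewrite dot0r.
rewrite psumr_eq0 => [/allP x0|i _]; last by rewrite -expr2 sqr_ge0.
apply/rowP => i; move: (x0 i (mem_index_enum i)).
by rewrite /= -expr2 sqrf_eq0 mxE => /eqP.
Qed.

Lemma dot_gt0 x : (0 < dot x x) = (x != 0).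
Proof. by rewrite lt0r dot_eq0 dot_ge0 andbT. Qed.

Lemma dot_CS x y : dot x y ^+ 2 <= dot x x * dot y y.
Proof.
have [->|y0] := eqVneq y 0; first by rewrite !dot0r expr0n mulr0.
have yy : 0 < dot y y by rewrite dot_gt0.
have := dot_ge0 (dot y y *: x - dot x y *: y).
rewrite !dotlin (dotC y x) => h.
suff: 0 <= dot y y * (dot x x * dot y y - dot x y ^+ 2).
  by rewrite pmulr_rge0 // subr_ge0.
by rewrite (le_trans h) // le_eqVlt; apply/orP; left; apply/eqP; ring.
Qed.

(** The vectors orthogonal to both rows of [D] fill the kernel of [D^T], which has rank one and is
    therefore spanned by [x]. *)
Lemma rank2_colinear (D : 'M[R]_(2, 3)) x y :
  \rank D = 2 -> (forall i, dot x (row i D) = 0) ->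
  (forall i, dot y (row i D) = 0) -> x != 0 -> exists a, y = a *: x.
Proof.
have inK z : (forall i, dot z (row i D) = 0) -> (z <= kermx D^T)%MS.
  move=> h; apply/sub_kermxP/rowP => i; rewrite [RHS]mxE -(h i) mxE.
  by apply: eq_bigr => j _; rewrite !mxE.
move=> rD /inK xK /inK yK x0; apply/sub_rVP.
apply: submx_trans yK _.
have rx : \rank x = 1%N by rewrite rank_rV x0.
have rK : \rank (kermx D^T) = 1%N by rewrite mxrank_ker mxrank_tr rD.
by have [_ <-] := mxrank_leqif_sup xK; rewrite rx rK.
Qed.

Lemma rank3_orthogonal (D : 'M[R]_3) x :
  \rank D = 3 -> (forall i, dot x (row i D) = 0) -> x = 0.
Proof.
move=> rD h; have: x *m D^T = 0.
  apply/rowP => i; rewrite [RHS]mxE -(h i) mxE.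
  by apply: eq_bigr => j _; rewrite !mxE.
move/(congr1 (mulmx^~ (invmx D^T))); rewrite mulmxK ?mul0mx //.
by rewrite unitmx_tr -row_free_unit /row_free rD.
Qed.

Lemma exists_orthogonal_plane x : x != 0 ->
  exists D : 'M[R]_(2, 3), \rank D = 2 /\ forall i, dot x (row i D) = 0.
Proof.
move=> x0; have rx : \rank x = 1%N by rewrite rank_rV x0.
have: \rank (kermx x^T) = 2 by rewrite mxrank_ker mxrank_tr rx.
have := row_base_free (kermx x^T); have := eq_row_base (kermx x^T).
(* The number of rows of [row_base] is a rank; generalizing the matrix lets this number be rewritten
   to 2. *)
move: (row_base _) => B eqB fB rK; move: B eqB fB; rewrite rK => B eqB fB.
exists B; split=> [|i]; first exact/eqP.
have /sub_kermxP/(congr1 (fun M : 'M[R]_1 => M 0 0)) : (row i B <= kermx x^T)%MS.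
  by rewrite -eqB row_sub.
by rewrite -dot_mx dotC mxE.
Qed.

(** A one-sided inverse of a square matrix is two-sided, so biorthogonality alone makes both
    families bases, each giving the coordinates in the other. *)
Lemma biorthogonal (n e : 'I_3 -> point R) :
  (forall i j, dot (n i) (e j) = (i == j)%:R) ->
  (forall x, x = \sum_i dot (n i) x *: e i) /\
  (forall y, y = \sum_i dot y (e i) *: n i).
Proof.
move=> ne; pose A := \matrix_i n i; pose B := \matrix_i e i.
have AB : A *m B^T = 1%:M.
  by apply/matrixP => i j; rewrite !mxE -ne; apply: eq_bigr => k _; rewrite !mxE.
have BA : B^T *m A = 1%:M by exact: mulmx1C.
have key (C D : 'M[R]_3) y : C^T *m D = 1%:M -> y = \sum_i dot y (row i C) *: row i D.
  move=> CD; rewrite -[LHS]mulmx1 -CD mulmxA mulmx_sum_row.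
  apply: eq_bigr => i _; congr (_ *: _); rewrite mxE.
  by apply: eq_bigr => j _; rewrite !mxE.
split=> y.
  have AtB : A^T *m B = 1%:M by rewrite -[A^T *m B]trmxK trmx_mul trmxK BA trmx1.
  rewrite {1}(key A B y) //; apply: eq_bigr => i _.
  by rewrite dotC !rowK.
by rewrite {1}(key B A y) //; apply: eq_bigr => i _; rewrite !rowK.
Qed.

End Dot.

(** * Convex hulls and polar pairs *)

Definition ord_cons (T : Type) (k : nat) (x : T) (f : 'I_k -> T) (i : 'I_k.+1) : T :=
  if unlift ord0 i is Some j then f j else x.

Lemma codom_ord_cons (T : Type) (k : nat) (x : T) (f : 'I_k -> T) :
  codom (ord_cons x f) = x :: codom f.
Proof.
rewrite /codom /image_mem !enumT -!enumT enum_ordSl /= /ord_cons unlift_none -map_comp.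
by congr (_ :: _); apply: eq_map => i /=; rewrite liftK.
Qed.

Lemma ord_consP (k : nat) (P : 'I_k.+1 -> Prop) :
  P ord0 -> (forall j, P (lift ord0 j)) -> forall i, P i.
Proof. by move=> P0 Pj i; case: (unliftP ord0 i) => [j|] ->. Qed.

(** Closure under binary mixing instead of weighted sums, so that facts about hulls go by induction
    on points. The ratio is strictly between 0 and 1, so that a valid inequality that is tight at a
    mixture is tight at both of its parts. *)
Inductive hull (R : realType) (S : seq (point R)) : point R -> Prop :=
| hull_in x of x \in S : hull S x
| hull_mix t x y of 0 < t & t < 1 & hull S x & hull S y :
    hull S ((1 - t) *: x + t *: y).

Section Hull.
Variable R : realType.
Implicit Types (S : seq (point R)) (x y z : point R) (t : R).

Lemma hull_convex S t x y :
  0 <= t -> t <= 1 -> hull S x -> hull S y -> hull S ((1 - t) *: x + t *: y).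
Proof.
rewrite !le_eqVlt => /predU1P[<-|t0]; first by rewrite subr0 scale1r scale0r addr0.
case/predU1P=> [->|t1]; first by rewrite subrr scale1r scale0r add0r.
exact: hull_mix.
Qed.

Lemma hull_sub S S' x : (forall y, y \in S -> hull S' y) -> hull S x -> hull S' x.
Proof.
move=> sub; elim=> [y /sub //|t y z t0 t1 _ hy _ hz]; exact: hull_mix.
Qed.

Lemma hull_subset S S' x : {subset S <= S'} -> hull S x -> hull S' x.
Proof. by move=> sub; apply: hull_sub => y /sub; apply: hull_in. Qed.

Lemma hull_dot_le S n c x :
  (forall y, y \in S -> dot n y <= c) -> hull S x -> dot n x <= c.
Proof.
move=> le; elim=> [y /le //|t y z t0 t1 _ hy _ hz].
by rewrite !dotlin; nra.
Qed.

(** Induction on the number of points: the first weight is split off and the others, of sum [s], are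
    divided by [s]. *)
Lemma hull_sum S k (w : 'I_k -> R) (p : 'I_k -> point R) :
  (forall i, 0 <= w i) -> \sum_i w i = 1 -> (forall i, 0 < w i -> hull S (p i)) ->
  hull S (\sum_i w i *: p i).
Proof.
elim: k w p => [|k IH] w p w0; first by rewrite !big_ord0 => /eqP; rewrite eq_sym oner_eq0.
rewrite !big_ord_recl; set s := \sum_(i < k) _ => ws hp.
have s0 : 0 <= s by apply: sumr_ge0.
have w00 := w0 ord0.
have [s_0|sn0] := eqVneq s 0.
  have w10 : w ord0 = 1 by lra.
  rewrite w10 scale1r big1 => [|i _]; first by rewrite addr0; apply: hp; rewrite w10.
  have /eqP := s_0; rewrite psumr_eq0 => [|j _]; last exact: w0.
  move=> /allP /(_ i (mem_index_enum _)) /eqP ->.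
  by rewrite scale0r.
have {}s0 : 0 < s by rewrite lt0r sn0.
have IHs : hull S (\sum_(i < k) (w (lift ord0 i) / s) *: p (lift ord0 i)).
  apply: IH => [i|| i]; first by rewrite divr_ge0 // ltW.
    by rewrite -mulr_suml divff.
  by rewrite pmulr_lgt0 ?invr_gt0 //; apply: hp.
have -> : \sum_(i < k) w (lift ord0 i) *: p (lift ord0 i) =
   s *: \sum_(i < k) (w (lift ord0 i) / s) *: p (lift ord0 i).
  by rewrite scaler_sumr; apply: eq_bigr => i _; rewrite scalerA mulrC divfK.
have [w_0|w_n0] := eqVneq (w ord0) 0.
  rewrite w_0 scale0r add0r; have s1 : s = 1 by lra.
  by move: IHs; rewrite s1 scale1r.
have -> : w ord0 = 1 - s by lra.
apply: hull_mix => //; first by have := w0 ord0; rewrite le0r (negPf w_n0) /=; lra.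
by apply: hp; rewrite lt0r w_n0.
Qed.

Lemma hull_sum_cons S k a x (w : 'I_k -> R) (p : 'I_k -> point R) :
  0 <= a -> (forall i, 0 <= w i) -> a + \sum_i w i = 1 ->
  hull S x -> (forall i, hull S (p i)) -> hull S (a *: x + \sum_i w i *: p i).
Proof.
move=> a0 w0 sum1 Sx Sp.
have sumE (A : zmodType) (f : 'I_k.+1 -> A) (c : A) (g : 'I_k -> A) :
    f ord0 = c -> (forall i, f (lift ord0 i) = g i) -> \sum_i f i = c + \sum_i g i.
  by move=> f0 fS; rewrite big_ord_recl f0; congr (_ + _); apply: eq_bigr.
rewrite -(sumE _ (fun i => ord_cons a w i *: ord_cons x p i)); first last.
- by move=> i; rewrite /ord_cons liftK.
- by rewrite /ord_cons unlift_none.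
apply: hull_sum => [||i _].
- by elim/ord_consP => [|j]; rewrite /ord_cons ?unlift_none ?liftK.
- rewrite (sumE _ _ a w) //; first by rewrite /ord_cons unlift_none.
  by move=> i; rewrite /ord_cons liftK.
- by elim/ord_consP: i => [|j]; rewrite /ord_cons ?unlift_none ?liftK.
Qed.

Lemma hullP S x : hull S x <-> conv_hull S x.
Proof.
split=> [|[w [w0 [w1 ->]]]]; last first.
  by apply: hull_sum => // i _; apply: hull_in; apply: mem_nth.
elim=> [y yS|t y z t0 t1 _ [w [w0 [w1 ->]]] _ [w' [w'0 [w'1 ->]]]].
  have iS : (index y S < size S)%N by rewrite index_mem.
  exists (fun i => (i == Ordinal iS)%:R); split=> [i|]; first by rewrite ler0n.
  split; first by rewrite (bigD1 (Ordinal iS)) //= eqxx big1 ?addr0 // => i /negPf ->.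
  rewrite (bigD1 (Ordinal iS)) //= eqxx scale1r nth_index // big1 ?addr0 // => i.
  by move/negPf ->; rewrite scale0r.
exists (fun i => (1 - t) * w i + t * w' i); split=> [i|].
  by have := w0 i; have := w'0 i; nra.
split; first by rewrite big_split /= -!mulr_sumr w1 w'1 !mulr1 subrK.
rewrite !scaler_sumr -big_split; apply: eq_bigr => i _ /=.
by rewrite !scalerA -scalerDl.
Qed.

End Hull.

(* The fields [polar_extV] and [polar_extN] say that [V] and [N] are irredundant:
   no set of incidences contains another one. *)
Record polar (R : realType) (V N : seq (point R)) : Prop := Polar {
  polar_uniqV : uniq V;
  polar_uniqN : uniq N;
  polar_le : forall n v, n \in N -> v \in V -> dot n v <= 1;
  polar_hullV : forall x, (forall n, n \in N -> dot n x <= 1) -> hull V x;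
  polar_hullN : forall y, (forall v, v \in V -> dot y v <= 1) -> hull N y;
  polar_extV : forall v w, v \in V -> w \in V -> v <> w ->
    exists2 n, n \in N & dot n v = 1 /\ dot n w < 1;
  polar_extN : forall n m, n \in N -> m \in N -> n <> m ->
    exists2 v, v \in V & dot n v = 1 /\ dot m v < 1;
  polar_sizeV : (1 < size V)%N;
  polar_sizeN : (1 < size N)%N }.

Lemma polarC (R : realType) (V N : seq (point R)) : polar V N -> polar N V.
Proof.
case=> uV uN le hV hN eV eN sV sN; split=> //.
- by move=> n v nV vN; rewrite dotC le.
- by move=> x h; apply: hN => v vV; rewrite dotC h.
- by move=> x h; apply: hV => v vV; rewrite dotC h.
- by move=> v w vN wN /(eN v w vN wN)[n nV h]; exists n; rewrite // !(dotC n).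
- by move=> v w vN wN /(eV v w vN wN)[n nV h]; exists n; rewrite // -!(dotC n).
Qed.

Section Polar.
Variables (R : realType) (V N : seq (point R)).
Hypothesis VN : polar V N.
Implicit Types (x y z v w n m : point R).

Let le1 := polar_le VN.

Lemma polar_ballP x : hull V x <-> forall n, n \in N -> dot n x <= 1.
Proof.
split; last exact: (polar_hullV VN).
by move=> xV n nN; apply: hull_dot_le xV => v; apply: le1.
Qed.

Lemma polar_neighbor v : v \in V -> exists2 w, w \in V & v <> w.
Proof.
move=> vV; have := polar_uniqV VN; have := polar_sizeV VN.
case: V vV => [|a [|b s]] //= _ _; rewrite inE negb_or -andbA => /andP[ab _].
have [->|/eqP va] := eqVneq v a; last by exists a; rewrite // mem_head.
by exists b; [rewrite !inE eqxx orbT | exact/eqP].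
Qed.

Lemma polar_tight v : v \in V -> exists2 n, n \in N & dot n v = 1.
Proof.
move=> vV; have [w wV vw] := polar_neighbor vV.
by have [n nN [nv _]] := polar_extV VN vV wV vw; exists n.
Qed.

(** Tightness at a mixture passes to both of its parts, so the claim reduces to vertices, where it
    is [polar_extV]. *)
Lemma polar_exposed v x : v \in V -> hull V x ->
  (forall n, n \in N -> dot n v = 1 -> dot n x = 1) -> x = v.
Proof.
move=> vV; elim=> [w wV tw|t y z t0 t1 yV IHy zV IHz tw].
  have [//|/eqP wv] := eqVneq w v.
  have [n nN [nv]] := polar_extV VN vV wV (nesym wv).
  by rewrite (tw n nN nv) ltxx.
have yz n : n \in N -> dot n v = 1 -> dot n y = 1 /\ dot n z = 1.
  move=> nN /(tw n nN); rewrite !dotlin.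
  have := (polar_ballP y).1 yV n nN; have := (polar_ballP z).1 zV n nN.
  by move: (dot n y) (dot n z) => a b; split; nra.
have -> : y = v by apply: IHy => n nN nv; case: (yz n nN nv).
have -> : z = v by apply: IHz => n nN nv; case: (yz n nN nv).
by rewrite -scalerDl subrK scale1r.
Qed.

Lemma polar_hull_vertex S v : v \in V -> {subset S <= V} -> hull S v -> v \in S.
Proof.
move=> vV SV; suff: forall x, hull S x -> v = x -> v \in S by move=> h /h; apply.
move=> x; elim=> [y yS -> //|t y z t0 t1 yS IHy zS _ e].
have inV s : hull S s -> hull V s by apply: hull_subset.
suff yv : y = v by apply: IHy.
apply: (polar_exposed vV (inV y yS)) => n nN; rewrite {1}e !dotlin.
have := (polar_ballP y).1 (inV y yS) n nN.
have := (polar_ballP z).1 (inV z zS) n nN.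
by move: (dot n y) (dot n z) => a b; nra.
Qed.

(** Takes the place of a dimension theory of faces. A functional tight at a mixture of two distinct
    points is tight at both, which by induction supplies two vertices. Its polar form classifies the
    elements of [hull N]. *)
Lemma polar_two_vertices x : hull V x -> x \in V \/
  exists v w, [/\ v \in V, w \in V, v <> w &
    forall n, hull N n -> dot n x = 1 -> dot n v = 1 /\ dot n w = 1].
Proof.
elim=> [v vV|t y z t0 t1 yV IHy zV IHz]; first by left.
have yz n : hull N n -> dot n ((1 - t) *: y + t *: z) = 1 ->
    dot n y = 1 /\ dot n z = 1.
  move=> nN; have le s : hull V s -> dot n s <= 1.
    move=> sV; apply: hull_dot_le sV => v vV; rewrite dotC.
    by apply: hull_dot_le nN => m mN; rewrite dotC le1.
  rewrite !dotlin; have := le y yV; have := le z zV.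
  by move: (dot n y) (dot n z) => a b; split; nra.
case: IHy => [yV'|[v [w [vV wV vw tight]]]]; last first.
  right; exists v, w; split=> // n nN /(yz n nN)[ny _]; exact: tight.
case: IHz => [zV'|[v [w [vV wV vw tight]]]]; last first.
  right; exists v, w; split=> // n nN /(yz n nN)[_ nz]; exact: tight.
have [->|/eqP ny] := eqVneq y z; first by left; rewrite -scalerDl subrK scale1r.
by right; exists y, z; split.
Qed.

End Polar.

(** * Edges *)

Lemma count_gt1P (T : eqType) (p : pred T) (s : seq T) : uniq s ->
  reflect (exists x y, [/\ x \in s, y \in s, x != y, p x & p y]) (1 < count p s)%N.
Proof.
move=> us; apply: (iffP idP) => [|[x [y [xs ys xy px py]]]].
  rewrite -size_filter; case E : (filter p s) => [|x [|y t]] // _; exists x, y.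
  have sub z : z \in filter p s -> p z && (z \in s) by rewrite mem_filter.
  have /andP[px xs] : p x && (x \in s) by apply: sub; rewrite E mem_head.
  have /andP[py ys] : p y && (y \in s) by apply: sub; rewrite E !inE eqxx orbT.
  split=> //; have := filter_uniq p us; rewrite E /= inE negb_or.
  by case/andP=> /andP[].
rewrite -size_filter; apply: (@uniq_leq_size _ [:: x; y]); first by rewrite /= inE xy.
by move=> z; rewrite !inE mem_filter => /orP[]/eqP ->; apply/andP.
Qed.

Lemma sum_pairs_count (T : eqType) (p : pred T) (s : seq T) : uniq s ->
  (\sum_(x <- s) \sum_(y <- s) [&& x != y, p x & p y] = count p s * (count p s).-1)%N.
Proof.
move=> us; transitivity (\sum_(x <- s) p x * (count p s).-1)%N; last first.
  rewrite -big_distrl; congr (_ * _)%N; rewrite -sum1_count [RHS]big_mkcond.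
  by apply: eq_bigr => x _; case: (p x).
apply: eq_big_seq => x xs; case px : (p x); last first.
  by rewrite mul0n big1 // => y _; rewrite /= andbF.
have -> : (count p s).-1 = (\sum_(y <- s | y != x) p y)%N.
  rewrite -sum1_count big_mkcond (bigD1_seq x) //= px add1n succnK.
  by apply: eq_bigr => y _; case: (p y).
rewrite mul1n (bigD1_seq x) //= eqxx add0n; apply: eq_bigr => y.
by rewrite eq_sym => ->.
Qed.

Section Edges.
Variable R : realType.
Implicit Types (V N : seq (point R)) (v w x y z n m : point R).

Definition common v w : pred (point R) := fun n => (dot n v == 1) && (dot n w == 1).

Definition adj N v w := (v != w) && (1 < count (common v w) N)%N.

(* Two vertices span an edge iff they lie on two common facets, so this is twice the
   number of edges. *)
Definition darts V N : nat := \sum_(v <- V) \sum_(w <- V) adj N v w.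

Lemma commonC v w : common v w =1 common w v.
Proof. by move=> n; rewrite /common andbC. Qed.

Lemma adjC N v w : adj N v w = adj N w v.
Proof. by rewrite /adj eq_sym (eq_count (commonC v w)). Qed.

Lemma adjP N v w : uniq N ->
  reflect (v != w /\ exists n m, [/\ n \in N, m \in N, n != m, common v w n & common v w m])
    (adj N v w).
Proof. by move=> uN; apply: (iffP andP) => -[vw /(count_gt1P _ uN)]. Qed.

Lemma rank2_independent x y :
  (forall a b, a *: x + b *: y = 0 -> a = 0 /\ b = 0) ->
  exists D : 'M[R]_(2, 3), [/\ \rank D = 2, row 0 D = x & row 1 D = y].
Proof.
move=> ind; exists (\matrix_(i < 2) (if i == 0 then x else y)).
split; last 2 first; rewrite ?rowK //.
apply/eqP/inj_row_free => u; rewrite mulmx_sum_row !big_ord_recl big_ord0 addr0 !rowK /=.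
case/ind => u0 u1; apply/rowP => i; rewrite mxE.
have [->|->] : i = 0 \/ i = 1.
- by case: i => [[|[|//]] ?]; [left|right]; apply: val_inj.
- by [].
by rewrite -u1; congr (u _ _); apply: val_inj.
Qed.

(** Pairing [a *: n + b *: m = 0] with [x] gives a + b = 0, so distinct [n] and [m] are independent
    and the vectors orthogonal to both form a line. *)
Lemma colinear_tight n m x y : n <> m ->
  dot n x = 1 -> dot m x = 1 -> dot n y = 0 -> dot m y = 0 ->
  forall z, y != 0 -> dot n z = 0 -> dot m z = 0 -> exists a, z = a *: y.
Proof.
move=> nm nx mx ny my z y0 nz mz.
have [a b ab0|D [rD D0 D1]] := @rank2_independent n m.
  have /eqP := congr1 (dot x) ab0.
  rewrite !dotlin !(dotC x) nx mx dot0l !mulr1 addr_eq0 => /eqP ab.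
  move: ab0; rewrite ab scaleNr addrC -scalerBr => /eqP.
  rewrite scaler_eq0 subr_eq0 => /orP[/eqP b0|/eqP /esym //].
  by rewrite b0 oppr0.
have I2 (i : 'I_2) : i = 0 \/ i = 1.
  by case: i => [[|[|//]] ?]; [left|right]; apply: val_inj.
by apply: (rank2_colinear rD) => // i; case: (I2 i) => ->; rewrite ?D0 ?D1 dotC.
Qed.

End Edges.

Section PolarEdges.
Variables (R : realType) (V N : seq (point R)).
Hypothesis VN : polar V N.
Implicit Types (x y z v w n m : point R).

Lemma polar_between x y z t : x \in V -> y \in V -> z \in V ->
  0 < t -> t < 1 -> x = (1 - t) *: y + t *: z -> x = y \/ x = z.
Proof.
move=> xV yV zV t0 t1 e; have : x \in [:: y; z].
  apply: (polar_hull_vertex VN) => //; first by move=> s; rewrite !inE => /orP[]/eqP ->.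
  by rewrite e; apply: hull_mix => //; apply: hull_in; rewrite !inE eqxx ?orbT.
by rewrite !inE => /orP[]/eqP; [left|right].
Qed.

(** Of three distinct points on a line one lies between the other two, which no vertex does; the
    cases are the positions of [a] relative to 0 and 1. *)
Lemma polar_colinear x y z a : x \in V -> y \in V -> z \in V ->
  y != x -> z = x + a *: (y - x) -> z = x \/ z = y.
Proof.
move=> xV yV zV yx e.
have [a0|] := ltrP a 0.
  have a1 : 1 - a != 0 by apply/negP => /eqP; lra.
  have xe : x = (1 - (1 - a)^-1 * (- a)) *: z + ((1 - a)^-1 * (- a)) *: y.
    by rewrite e; apply/rowP => i; rewrite !mxE; field.
  have [] : x = z \/ x = y.
  - apply: polar_between xe => //; first by apply: mulr_gt0; rewrite ?invr_gt0; lra.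
    by rewrite mulrC ltr_pdivrMr; lra.
  - by left.
  by move=> xy; rewrite xy eqxx in yx.
rewrite le_eqVlt => /predU1P[a0|a0]; first by left; rewrite e -a0 scale0r addr0.
have [a1|] := ltrP a 1.
  by apply: (polar_between zV xV yV a0 a1); rewrite e; apply/rowP => i; rewrite !mxE; ring.
rewrite le_eqVlt => /predU1P[a1|a1]; first by right; rewrite e -a1 scale1r addrC subrK.
have an0 : a != 0 by rewrite gt_eqF.
have ye : y = (1 - a^-1) *: x + a^-1 *: z.
  by rewrite e; apply/rowP => i; rewrite !mxE; field.
case: (polar_between yV xV zV _ _ ye); rewrite ?invr_gt0 ?invf_lt1 //.
  by move=> xy; rewrite xy eqxx in yx.
by right.
Qed.

Lemma polar_colinear_tight n m x y z : n \in N -> m \in N -> n <> m ->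
  x \in V -> y \in V -> z \in V -> y != x ->
  common x y n -> common x y m -> dot n z = 1 -> dot m z = 1 -> z = x \/ z = y.
Proof.
move=> nN mN nm xV yV zV yx /andP[/eqP nx /eqP ny] /andP[/eqP mx /eqP my] nz mz.
have [] := @colinear_tight _ n m x (y - x) nm nx mx _ _ (z - x).
all: rewrite ?subr_eq0 ?dotDr ?dotNr ?nx ?ny ?nz ?mx ?my ?mz ?subrr //.
by move=> a e; apply: (polar_colinear xV yV zV yx (a := a)); rewrite -e addrC subrK.
Qed.

End PolarEdges.

Section Darts.
Variables (R : realType) (V N : seq (point R)).
Hypothesis VN : polar V N.
Implicit Types (x y z v w n m : point R).

(** Polar to the fact that a line carries at most two vertices: the normals tight at both [v] and
    [w] are vertices of the polar body on one line. *)
Lemma polar_count_common v w : v \in V -> w \in V -> v != w ->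
  (count (common v w) N <= 2)%N.
Proof.
move=> vV wV vw; rewrite leqNgt -size_filter; apply/negP.
have := filter_uniq (common v w) (polar_uniqN VN).
case E : (filter _ N) => [|n [|m [|k s]]] //= /and3P[].
rewrite !inE !negb_or => /and3P[nm nk _] /andP[mk _] _ _.
have sub z : z \in filter (common v w) N -> common v w z && (z \in N).
  by rewrite mem_filter.
have /andP[/andP[/eqP nv /eqP nw] nN] : common v w n && (n \in N).
  by apply: sub; rewrite E mem_head.
have /andP[/andP[/eqP mv /eqP mw] mN] : common v w m && (m \in N).
  by apply: sub; rewrite E !inE eqxx orbT.
have /andP[/andP[/eqP kv /eqP kw] kN] : common v w k && (k \in N).
  by apply: sub; rewrite E !inE eqxx !orbT.
have [|||||/eqP|/eqP] := polar_colinear_tight (polarC VN) vV wV (elimN eqP vw) nN mN kN.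
- by rewrite eq_sym.
all: rewrite /common ?(dotC v) ?(dotC w) ?nv ?nw ?mv ?mw ?eqxx //.
- by rewrite eq_sym (negPf nk).
- by rewrite eq_sym (negPf mk).
Qed.

(* The right-hand side is symmetric under polarity. *)
Lemma darts_quads : (2 * darts V N =
  \sum_(v <- V) \sum_(w <- V) \sum_(n <- N) \sum_(m <- N)
    [&& v != w, n != m, common v w n & common v w m])%N.
Proof.
rewrite /darts big_distrr; apply: eq_big_seq => v vV.
rewrite big_distrr; apply: eq_big_seq => w wV /=.
have [<-|vw] := eqVneq v w.
  by rewrite /adj eqxx big1 // => n _; rewrite big1.
rewrite sum_pairs_count ?(polar_uniqN VN) // /adj vw.
(* With a count c of common normals that is at most 2, c (c - 1) is 2 for an edge and 0
   otherwise. *)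
by have := polar_count_common vV wV vw; case: (count _ _) => [|[|[|]]].
Qed.

End Darts.

(** Two vertices sharing two facets are the same data as two facets sharing two vertices, so only
    the order of summation changes. *)
Lemma darts_polarC (R : realType) (V N : seq (point R)) :
  polar V N -> darts V N = darts N V.
Proof.
move=> VN; apply/eqP; rewrite -(eqn_pmul2l (isT : 0 < 2)%N) (darts_quads VN).
rewrite (darts_quads (polarC VN)); apply/eqP.
under eq_bigr do rewrite exchange_big.
rewrite exchange_big; apply: eq_bigr => n _.
under eq_bigr do rewrite exchange_big.
rewrite exchange_big; apply: eq_bigr => m _.
apply: eq_bigr => v _; apply: eq_bigr => w _; congr nat_of_bool.
rewrite /common !(dotC v) !(dotC w).
by case: (v != w); case: (n != m); rewrite //= andbACA.
Qed.

(** * Cutting off a vertex *)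

(** Makes [q] a vertex of degree three. The indices follow the convention for a simplex: [u i] is
    the neighbor along the edge common to the two facets other than [n i], so [n i] is the facet at
    [q] that misses [u i]. *)
Record corner (R : realType) (V N : seq (point R)) (q : point R)
    (n u : 'I_3 -> point R) : Prop := Corner {
  corner_q : q \in V;
  corner_n : forall i, n i \in N;
  corner_nq : forall i, dot (n i) q = 1;
  corner_tight : forall m, m \in N -> dot m q = 1 -> exists i, m = n i;
  corner_u : forall i, u i \in V;
  corner_nu : forall i j, i != j -> dot (n i) (u j) = 1;
  corner_gap : forall i, dot (n i) (u i) < 1 }.

Section CutDefs.
Variables (R : realType) (V N : seq (point R)) (q : point R).
Variables (n u : 'I_3 -> point R) (k : 'I_3 -> R).

(** Also the factor between the edge vector [q - u i] and the vector dual to [n i]. *)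
Definition gap i := 1 - dot (n i) (u i).

(* The plane through the points [cut_vertex i], which divide the edges issued from [q]
   in the ratio [(k i * gap i)^-1]. *)
Definition cut_facet := (\sum_i k i - 1)^-1 *: \sum_i k i *: n i.

Definition cut_vertex i := q + (k i * gap i)^-1 *: (u i - q).

(* When [k i * gap i = 1] the cutting plane passes through the vertex [u i]. *)
Definition cut_index := [seq i <- enum 'I_3 | k i * gap i != 1].

Definition cut_vertices := map cut_vertex cut_index ++ rem q V.

Definition cut_facets := cut_facet :: N.

End CutDefs.

Lemma hull_simplex (R : realType) (S : seq (point R)) (q : point R)
    (u : 'I_3 -> point R) (t : 'I_3 -> R) :
  (forall i, 0 <= t i) -> \sum_i t i <= 1 -> q \in S -> (forall i, u i \in S) ->
  hull S (q + \sum_i t i *: (u i - q)).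
Proof.
move=> t0 t1 qS uS.
have -> : q + \sum_i t i *: (u i - q) = (1 - \sum_i t i) *: q + \sum_i t i *: u i.
  rewrite scalerBl scale1r -addrA; congr (_ + _); rewrite scaler_suml addrC -sumrB.
  by apply: eq_bigr => i _; rewrite scalerBr.
apply: hull_sum_cons; rewrite ?subr_ge0 ?subrK //; first exact: hull_in.
by move=> i; apply: hull_in.
Qed.

Lemma ord3_other (i : 'I_3) : exists j1 j2, [/\ j1 != i, j2 != i & j1 != j2].
Proof.
by case: i => [[|[|[|//]]] ?]; [exists (inord 1), (inord 2)|exists (inord 0), (inord 2)|
  exists (inord 0), (inord 1)]; rewrite -!(inj_eq val_inj) /= !inordK.
Qed.

Lemma ord3_third (i j : 'I_3) : exists l, l != i /\ l != j.
Proof.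
have [j1 [j2 [j1i j2i j12]]] := ord3_other i.
have [E|j1j] := eqVneq j1 j; last by exists j1.
by exists j2; split; rewrite // -E eq_sym.
Qed.

Section Cut.
Variables (R : realType) (V N : seq (point R)) (q : point R).
Variables (n u : 'I_3 -> point R) (k : 'I_3 -> R).
Hypotheses (VN : polar V N) (C : corner V N q n u).
(** Each cutting point lies on its edge, and at most one of them is the neighbor at the far end. The
    bound on the sum of [k] keeps the origin, where every slack [1 - dot (n i) x] is 1, strictly on
    the kept side, so that the new normal can be scaled to level 1. *)
Hypothesis k_ge : forall i, 1 <= k i * gap n u i.
Hypothesis k_gt : forall i j, i != j -> k i * gap n u i = 1 -> 1 < k j * gap n u j.
Hypothesis K_gt1 : 1 < \sum_i k i.

Local Notation g := (gap n u).
Local Notation K := (\sum_i k i).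
Local Notation h := (cut_facet n k).
Local Notation a := (cut_vertex q n u k).
Local Notation V' := (cut_vertices V q n u k).
Local Notation N' := (cut_facets N n k).
(** Edge vectors at [q], rescaled to the basis dual to [n]. *)
Let e i := (g i)^-1 *: (q - u i).

Lemma gap_gt0 i : 0 < g i. Proof. by rewrite subr_gt0 (corner_gap C). Qed.

Lemma cut_k_gt0 i : 0 < k i.
Proof. by have := k_ge i; have := gap_gt0 i; nra. Qed.

Let ne i j : dot (n i) (e j) = (i == j)%:R.
Proof.
rewrite !(dotDr, dotNr, dotZr) (corner_nq C); have [->|ij] := eqVneq i j.
  by rewrite mulVf // gt_eqF ?gap_gt0.
by rewrite (corner_nu C ij) subrr mulr0.
Qed.

Let e_basis x : x = \sum_i dot (n i) x *: e i.
Proof. exact: (biorthogonal ne).1. Qed.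

Let n_basis y : y = \sum_i dot y (e i) *: n i.
Proof. exact: (biorthogonal ne).2. Qed.

Let qE : q = \sum_i e i.
Proof. by rewrite {1}[q]e_basis; apply: eq_bigr => i _; rewrite (corner_nq C) scale1r. Qed.

Let gK i : g i *: e i = q - u i.
Proof. by rewrite /e scalerA mulfV ?scale1r // gt_eqF ?gap_gt0. Qed.

Let aE i : a i = q - (k i)^-1 *: e i.
Proof. by rewrite /cut_vertex /e scalerA -invfM mulrC -scalerN opprB. Qed.

Let qE_edges x : x = q + \sum_i ((1 - dot (n i) x) / g i) *: (u i - q).
Proof.
have -> : \sum_i ((1 - dot (n i) x) / g i) *: (u i - q) =
    \sum_i (dot (n i) x *: e i - e i).
  apply: eq_bigr => i _; rewrite -[u i - q]opprB -gK scalerN scalerA divfK.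
    by rewrite scalerBl scale1r opprB.
  by rewrite gt_eqF ?gap_gt0.
by rewrite sumrB -qE -e_basis addrC subrK.
Qed.

Let na i j : i != j -> dot (n i) (a j) = 1.
Proof. by move=> ij; rewrite aE dotDr dotNr dotZr ne (negPf ij) (corner_nq C) mulr0 subr0. Qed.

Let na_lt i : dot (n i) (a i) < 1.
Proof.
rewrite aE dotDr dotNr dotZr ne eqxx (corner_nq C) mulr1 -subr_gt0 opprB addrC subrK.
by rewrite invr_gt0 cut_k_gt0.
Qed.

Let hE x : dot h x = (K - 1)^-1 * (K - \sum_i k i * (1 - dot (n i) x)).
Proof.
rewrite dotZl dot_suml; congr (_ * _).
rewrite -sumrB; apply: eq_bigr => i _; rewrite dotZl; ring.
Qed.

Let K1 : 0 < K - 1. Proof. by rewrite subr_gt0. Qed.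

Let K1n : K - 1 != 0. Proof. by rewrite gt_eqF. Qed.

(** The slacks [1 - dot (n i) x] serve as coordinates centered at [q]; in them the cut compares a
    weighted sum with 1. *)
Let h_le1 x : (dot h x <= 1) = (1 <= \sum_i k i * (1 - dot (n i) x)).
Proof. by rewrite hE mulrC ler_pdivrMr // mul1r; apply/idP/idP; lra. Qed.

Let h_eq1 x : (dot h x == 1) = (\sum_i k i * (1 - dot (n i) x) == 1).
Proof.
rewrite hE mulrC (can2_eq (divfK K1n) (mulfK K1n)) mul1r.
by apply/eqP/eqP; lra.
Qed.

Lemma cut_facet_q : 1 < dot h q.
Proof.
rewrite ltNge h_le1 big1 ?ler10 // => i _.
by rewrite (corner_nq C) subrr mulr0.
Qed.

Lemma cut_facet_vertex i : dot h (a i) = 1.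
Proof.
apply/eqP; rewrite h_eq1 (bigD1 i) //= big1 ?addr0 => [|j ji]; last first.
  by rewrite na // subrr mulr0.
rewrite aE dotDr dotNr dotZr ne eqxx (corner_nq C) mulr1 opprB addrC subrK.
by rewrite mulfV // gt_eqF ?cut_k_gt0.
Qed.

Lemma corner_neighbor_neq i : u i != q.
Proof. by apply/eqP => E; have := corner_gap C i; rewrite E (corner_nq C) ltxx. Qed.

(** For a neighbor [u i] the value on [h] is explicit. Any other vertex not strictly below the plane
    would have a weighted slack sum at most 1, hence by [k_ge] lie in the simplex of [q] and its
    three neighbors, against extremality. *)
Lemma cut_facet_old w : w \in V -> w != q ->
  dot h w <= 1 /\ (dot h w = 1 -> exists2 i, w = u i & k i * g i = 1).
Proof.
move=> wV wq; case: (boolP [exists i, w == u i]) => [/existsP[i /eqP ->]|].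
  have -> : dot h (u i) = (K - 1)^-1 * (K - k i * g i).
    rewrite hE; congr (_ * (_ - _)); rewrite (bigD1 i) //= big1 ?addr0 // => j ji.
    by rewrite (corner_nu C ji) subrr mulr0.
  split; first by rewrite mulrC ler_pdivrMr // mul1r; have := k_ge i; lra.
  move=> E; exists i => //; have := mulVKf K1n (K - k i * g i).
  by rewrite E mulr1 => /eqP; lra.
rewrite negb_exists => /forallP wu.
suff: dot h w < 1 by move=> lt; split; [exact: ltW | move=> E; rewrite E ltxx in lt].
rewrite ltNge; apply/negP => ge1.
have le1 i : 0 <= 1 - dot (n i) w.
  by rewrite subr_ge0 (polar_le VN) // (corner_n C).
have: w \in q :: codom u.
  apply: (polar_hull_vertex VN wV).
    move=> s; rewrite inE => /orP[/eqP ->|/codomP[i ->]]; first exact: corner_q C.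
    exact: (corner_u C i).
  rewrite [w]qE_edges; apply: hull_simplex => [i|||i].
  - by rewrite divr_ge0 // ltW ?gap_gt0.
  - apply: (@le_trans _ _ (\sum_i k i * (1 - dot (n i) w))).
      apply: ler_sum => i _; rewrite ler_pdivrMr ?gap_gt0 //.
      have := k_ge i; have := le1 i; nra.
    move: ge1; rewrite hE mulrC ler_pdivlMr // mul1r; lra.
  - exact: mem_head.
  - by rewrite inE codom_f orbT.
rewrite inE (negPf wq) /= => /codomP[i wi].
by have := wu i; rewrite wi eqxx.
Qed.

Lemma cut_vertex_sharp i : k i * g i = 1 -> a i = u i.
Proof. by move=> kg; rewrite /cut_vertex kg invr1 scale1r addrC subrK. Qed.

Lemma cut_vertex_mix i : a i = (1 - (k i * g i)^-1) *: q + (k i * g i)^-1 *: u i.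
Proof. by apply/rowP => j; rewrite !mxE; ring. Qed.

Lemma cut_ratio i : 0 < (k i * g i)^-1 <= 1.
Proof.
have kg : 0 < k i * g i := lt_le_trans ltr01 (k_ge i).
by rewrite invr_gt0 kg invf_le1 ?k_ge.
Qed.

Lemma cut_ratio_lt1 i : k i * g i != 1 -> (k i * g i)^-1 < 1.
Proof.
move=> kg; have k1 : 1 < k i * g i by rewrite lt_neqAle eq_sym kg k_ge.
by rewrite invf_lt1 // (lt_trans ltr01).
Qed.

Lemma cut_vertex_hull i : hull V (a i).
Proof.
rewrite cut_vertex_mix; have /andP[r0 r1] := cut_ratio i.
apply: hull_convex => //; first exact: ltW.
  by apply: hull_in; apply: corner_q C.
by apply: hull_in; exact: (corner_u C _).
Qed.

Lemma mem_cut w : (w \in V') =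
  [exists i, (k i * g i != 1) && (w == a i)] || ((w \in V) && (w != q)).
Proof.
rewrite mem_cat (mem_rem_uniq _ (polar_uniqV VN)) inE; congr (_ || _); last exact: andbC.
apply/mapP/existsP => [[i]|[i /andP[ki /eqP ->]]].
  by rewrite mem_filter => /andP[ki _] ->; exists i; rewrite ki eqxx.
by exists i; rewrite // mem_filter ki mem_enum.
Qed.

Lemma mem_cut_vertex i : a i \in V'.
Proof.
rewrite mem_cut; have [kg|kg] := eqVneq (k i * g i) 1.
  by rewrite (cut_vertex_sharp kg) (corner_u C) corner_neighbor_neq orbT.
by apply/orP; left; apply/existsP; exists i; rewrite kg eqxx.
Qed.

Lemma mem_cut_old w : w \in V -> w != q -> w \in V'.
Proof. by rewrite mem_cut => -> ->; rewrite orbT. Qed.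

Lemma cutP w : w \in V' -> (exists2 i, k i * g i != 1 & w = a i) \/ (w \in V /\ w != q).
Proof.
by rewrite mem_cut => /orP[/existsP[i /andP[ki /eqP ->]]|/andP[]]; [left; exists i|right].
Qed.

Lemma cut_vertex_tight i m : k i * g i != 1 -> m \in N -> dot m (a i) = 1 ->
  dot m q = 1 /\ dot m (u i) = 1.
Proof.
move=> ki mN; rewrite cut_vertex_mix !(dotDr, dotNr, dotZr).
have := polar_le VN mN (corner_q C); have := polar_le VN mN (corner_u C i).
have := cut_ratio_lt1 ki; have /andP[] := cut_ratio i.
by move: (_^-1) (dot m q) (dot m (u i)) => r b c; split; nra.
Qed.

Lemma cut_vertex_lt i m : k i * g i != 1 -> m \in N -> dot m q < 1 -> dot m (a i) < 1.
Proof.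
move=> ki mN mq; rewrite lt_neqAle (polar_ballP VN (a i)).1 ?andbT //; last exact: cut_vertex_hull.
by apply/eqP => /(cut_vertex_tight ki mN)[E]; rewrite E ltxx in mq.
Qed.

Lemma cut_vertex_tightP i m : k i * g i != 1 -> m \in N -> dot m (a i) = 1 ->
  exists2 j, j != i & m = n j.
Proof.
move=> ki mN /(cut_vertex_tight ki mN)[/(corner_tight C mN)[j ->] nu]; exists j => //.
by apply/eqP => E; have := corner_gap C i; rewrite -{1}E nu ltxx.
Qed.

Lemma cut_vertex_notin i : k i * g i != 1 -> a i \notin V.
Proof.
move=> ki; apply/negP => aV; have : a i \in [:: q; u i].
  apply: (polar_hull_vertex VN aV).
    by move=> s; rewrite !inE => /orP[]/eqP ->; [apply: corner_q C|exact: (corner_u C _)].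
  have /andP[r0 r1] := cut_ratio i.
  by rewrite cut_vertex_mix; apply: hull_mix; rewrite ?cut_ratio_lt1 //;
    apply: hull_in; rewrite !inE eqxx ?orbT.
rewrite !inE => /orP[]/eqP E; last first.
  have := congr1 (dot (n i)) E.
  rewrite aE dotDr dotNr dotZr ne eqxx (corner_nq C) mulr1 => E'.
  move/eqP: ki; apply; rewrite /gap -E' opprB addrC subrK mulfV //.
  by rewrite gt_eqF ?cut_k_gt0.
by have := na_lt i; rewrite E (corner_nq C) ltxx.
Qed.

Lemma cut_vertex_inj : injective a.
Proof.
move=> i j E; apply/eqP; apply: contraT => ij.
by have := na_lt i; rewrite E na // ltxx.
Qed.

(** Induction over the construction of the point in the old hull: when a mixture uses a point beyond
    the cutting plane, that point is replaced by the place where the segment crosses the plane. *)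
Lemma cut_hullV x : (forall m, m \in N' -> dot m x <= 1) -> hull V' x.
Proof.
(* On the plane the numbers [k i * (1 - dot (n i) z)] are nonnegative with sum 1; they are the
   barycentric coordinates of [z] in the triangle of the cutting points. *)
have face z : hull V z -> dot h z = 1 -> hull V' z.
  move=> zV /eqP; rewrite h_eq1 => /eqP w1.
  have -> : z = \sum_i (k i * (1 - dot (n i) z)) *: a i.
    transitivity (\sum_i ((k i * (1 - dot (n i) z)) *: q - (1 - dot (n i) z) *: e i)).
      rewrite sumrB -scaler_suml w1 scale1r.
      under [X in _ - X]eq_bigr do rewrite scalerBl scale1r.
      by rewrite sumrB -qE -e_basis opprB addrC subrK.
    apply: eq_bigr => i _; rewrite aE scalerBr (scalerA _ _ (e i)); congr (_ - _ *: _).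
    by rewrite mulrAC mulfV ?mul1r // gt_eqF ?cut_k_gt0.
  apply: hull_sum => // [i|i _]; last by apply: hull_in; apply: mem_cut_vertex.
  rewrite mulr_ge0 ?(ltW (cut_k_gt0 i)) // subr_ge0.
  by apply: (polar_ballP VN z).1 => //; exact: (corner_n C _).
have cross y z t : 0 < t -> t < 1 -> hull V y -> hull V z -> dot h z <= 1 ->
    (dot h z <= 1 -> hull V' z) -> 1 < dot h y ->
    dot h ((1 - t) *: y + t *: z) <= 1 -> hull V' ((1 - t) *: y + t *: z).
  move=> t0 t1 yV zV hz IHz hy; rewrite !(dotDr, dotNr, dotZr) => hx.
  (* The parameter at which the segment from [y] to [z] meets the plane. *)
  pose s := (dot h y - 1) / (dot h y - dot h z).
  have d0 : 0 < dot h y - dot h z by lra.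
  have s0 : 0 < s by rewrite divr_gt0 //; lra.
  have s1 : s <= 1 by rewrite ler_pdivrMr // mul1r; lra.
  have st : s <= t by rewrite ler_pdivrMr //; lra.
  have sE : s * (dot h y - dot h z) = dot h y - 1 by rewrite divfK // gt_eqF.
  have cV : hull V' ((1 - s) *: y + s *: z).
    by apply: face; [apply: hull_convex => //; exact: ltW | rewrite !(dotDr, dotNr, dotZr); lra].
  have [s_1|s_1] := eqVneq s 1; first by exfalso; lra.
  have s1' : 0 < 1 - s by rewrite subr_gt0 lt_neqAle s_1.
  pose r := (t - s) / (1 - s).
  have rE : r * (1 - s) = t - s by rewrite divfK // gt_eqF.
  have -> : (1 - t) *: y + t *: z = (1 - r) *: ((1 - s) *: y + s *: z) + r *: z.
    apply/rowP => i; rewrite !mxE.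
    have -> : t = s + r * (1 - s) by lra.
    by ring.
  apply: hull_convex => //; last exact: IHz.
    by rewrite divr_ge0 ?subr_ge0 // ltW.
  by rewrite ler_pdivrMr //; lra.
move=> le1; have: dot h x <= 1 by apply: le1; apply: mem_head.
have: hull V x by apply: (polar_ballP VN x).2 => m mN; apply: le1; rewrite inE mN orbT.
elim=> [v vV hv|t y z t0 t1 yV IHy zV IHz hx].
  apply: hull_in; apply: mem_cut_old => //.
  by apply/eqP => E; have := cut_facet_q; rewrite -E ltNge hv.
have [hy|hy] := lerP (dot h y) 1; have [hz|hz] := lerP (dot h z) 1.
- by apply: hull_mix; auto.
- rewrite addrC -{1}[t](subKr 1); apply: cross => //; try lra.
  by rewrite subKr addrC.
- exact: cross.
- by exfalso; move: hx; rewrite !(dotDr, dotNr, dotZr); nra.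
Qed.

(** Only the constraint at [q] is lost. If it fails by [d > 0], expand [y] in [h] and the [n i]: the
    constraint at the cutting point [a i] says exactly that the coefficient [dot y (e i) - k i * d]
    is nonnegative, and all coefficients sum to 1. *)
Lemma cut_hullN y : (forall v, v \in V' -> dot y v <= 1) -> hull N' y.
Proof.
move=> le1; have [yq|yq] := lerP (dot y q) 1.
  apply: (@hull_subset _ N) => [m mN|]; first by rewrite inE mN orbT.
  apply: (polar_hullN VN) => v vV.
  by have [->//|vq] := eqVneq v q; apply: le1; apply: mem_cut_old.
pose d := dot y q - 1.
have ke i : k i * d <= dot y (e i).
  have := le1 _ (mem_cut_vertex i); rewrite aE dotDr dotNr dotZr.
  rewrite lerBlDr -lerBlDl -/d mulrC ler_pdivlMr ?cut_k_gt0 //; lra.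
have -> : y = (d * (K - 1)) *: h + \sum_i (dot y (e i) - k i * d) *: n i.
  rewrite /cut_facet scalerA mulfK ?gt_eqF // {1}[y]n_basis scaler_sumr -big_split.
  by apply: eq_bigr => i _ /=; rewrite scalerA -scalerDl mulrC addrC subrK.
apply: hull_sum_cons => [|i|||i].
- by rewrite mulr_ge0 // ltW // /d subr_gt0.
- by rewrite subr_ge0.
- by rewrite sumrB -mulr_suml -dot_sumr -qE /d; ring.
- by apply: hull_in; apply: mem_head.
- by apply: hull_in; rewrite inE (corner_n C) orbT.
Qed.


(** An index is called sharp when the plane passes through [u i], so that no new vertex arises on
    that edge, and blunt otherwise. *)
Let sharp_uniq i j : k i * g i = 1 -> k j * g j = 1 -> i = j.
Proof.
move=> si sj; apply/eqP; apply: contraT => ij.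
by have := k_gt ij si; rewrite sj ltxx.
Qed.

Let blunt_other (i : 'I_3) : exists2 j, j != i & k j * g j != 1.
Proof.
have [j1 [j2 [j1i j2i j12]]] := ord3_other i.
have [s1|s1] := eqVneq (k j1 * g j1) 1; last by exists j1.
exists j2 => //; apply/eqP => s2; move: j12.
by rewrite (sharp_uniq s1 s2) eqxx.
Qed.

Let n_inj : injective n.
Proof.
move=> i j E; apply/eqP; apply: contraT => ij; have := corner_gap C j.
by rewrite -E (corner_nu C ij) ltxx.
Qed.

Let u_inj : injective u.
Proof.
move=> i j E; apply/eqP; apply: contraT => ij; have := corner_gap C i.
by rewrite E (corner_nu C ij) ltxx.
Qed.

Lemma cut_facet_notin : h \notin N.
Proof.
apply/negP => /(polar_le VN)/(_ (corner_q C)).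
by rewrite leNgt cut_facet_q.
Qed.

Lemma cut_uniqV : uniq V'.
Proof.
rewrite cat_uniq (map_inj_uniq cut_vertex_inj) filter_uniq ?enum_uniq //=.
rewrite rem_uniq ?(polar_uniqV VN) // andbT; apply/hasPn => w /mem_rem wV.
apply/negP => /mapP[i]; rewrite mem_filter => /andP[ki _] E.
by have := cut_vertex_notin ki; rewrite -E wV.
Qed.

Lemma cut_le m v : m \in N' -> v \in V' -> dot m v <= 1.
Proof.
rewrite inE => /orP[/eqP ->|mN] /cutP[[i _ ->]|[vV vq]].
- by rewrite cut_facet_vertex.
- by case: (cut_facet_old vV vq).
- by apply: (polar_ballP VN (a i)).1 => //; apply: cut_vertex_hull.
- exact: (polar_le VN).
Qed.

(** Two new vertices are separated by a facet at [q]; a new one is separated from an old one by [h],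
    or by [n l] if the old one is a sharp [u l]. A normal tight at an old vertex but not at [q] is
    not tight inside an edge issued from [q]. *)
Lemma cut_extV v w : v \in V' -> w \in V' -> v <> w ->
  exists2 m, m \in N' & dot m v = 1 /\ dot m w < 1.
Proof.
have hN : h \in N' by apply: mem_head.
have NN m : m \in N -> m \in N' by rewrite inE => ->; rewrite orbT.
have nN i : n i \in N' by apply: NN; exact: (corner_n C _).
move=> /cutP[[i ki ->]|[vV vq]] /cutP[[j kj ->]|[wV wq]] vw.
- have ij : j != i by apply/eqP => E; apply: vw; rewrite E.
  by exists (n j); [exact: nN | rewrite na ?na_lt].
- have [hle heq] := cut_facet_old wV wq.
  have [h1|h1] := eqVneq (dot h w) 1; last first.
    by exists h; rewrite ?cut_facet_vertex // lt_neqAle h1.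
  have [l wl kl] := heq h1; exists (n l); rewrite // wl (corner_gap C) na //.
  by apply/eqP => E; rewrite -E kl eqxx in ki.
- have [m mN [mv mq]] := polar_extV VN vV (corner_q C) (elimN eqP vq).
  by exists m; rewrite ?NN // mv cut_vertex_lt.
- by have [m mN ?] := polar_extV VN vV wV vw; exists m; rewrite ?NN.
Qed.

Lemma cut_extN m m' : m \in N' -> m' \in N' -> m <> m' ->
  exists2 v, v \in V' & dot m v = 1 /\ dot m' v < 1.
Proof.
have mq_lt l : l \in N -> ~ (exists i, l = n i) -> dot l q < 1.
  move=> lN nl; rewrite lt_neqAle (polar_le VN) ?(corner_q C) // andbT.
  by apply/eqP => /(corner_tight C lN).
rewrite !inE => /orP[/eqP ->|mN] /orP[/eqP ->|m'N] mm' //.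
- case: (boolP [exists i, m' == n i]) => [/existsP[i /eqP ->]|].
    by exists (a i); [exact: mem_cut_vertex | rewrite cut_facet_vertex na_lt].
  move/existsP => nm'; have [j _ kj] := blunt_other ord0.
  exists (a j); rewrite ?mem_cut_vertex ?cut_facet_vertex //; split=> //.
  apply: cut_vertex_lt => //; apply: mq_lt => // -[i E].
  by apply: nm'; exists i; rewrite E.
(* The old facet [m] needs a vertex off the plane. Take a blunt [j] with [n j] different from [m],
   and a vertex of [m] off [n j]: it is neither [q] nor a sharp [u i], since those lie on [n j]. *)
- have [j nj sj] : exists2 j, m <> n j & forall i, k i * g i = 1 -> n j = n i -> False.
    have [i0 si0] : exists i0, forall i, k i * g i = 1 -> i = i0.
      case: (boolP [exists i, k i * g i == 1]) => [/existsP[i /eqP ki]|].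
        by exists i => j kj; apply: sharp_uniq.
      by move/existsP => none; exists ord0 => i /eqP ki; case: none; exists i.
    have [j1 [j2 [j1i j2i j12]]] := ord3_other i0.
    have ok j : j != i0 -> forall i, k i * g i = 1 -> n j = n i -> False.
      by move=> ji i /si0 -> /n_inj E; rewrite E eqxx in ji.
    have [E|/eqP ?] := eqVneq m (n j1); last by exists j1; rewrite //; apply: ok.
    exists j2; last exact: ok.
    by rewrite E => /n_inj E'; rewrite E' eqxx in j12.
  have [v vV [mv nv]] := polar_extN VN mN (corner_n C j) nj.
  have vq : v != q by apply/eqP => E; rewrite E (corner_nq C) ltxx in nv.
  exists v; first exact: mem_cut_old.
  split=> //; have [hle heq] := cut_facet_old vV vq.
  rewrite lt_neqAle hle andbT; apply/eqP => /heq[i vi ki].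
  have ji : j != i by apply/eqP => E; apply: (sj i ki); rewrite E.
  by move: nv; rewrite vi (corner_nu C ji) ltxx.
- have [v vV [mv m'v]] := polar_extN VN mN m'N mm'.
  (* If the witness is the lost [q], then [m] is some [n i], and a new vertex on an edge contained
     in [n i] replaces it. *)
  have [vq|vq] := eqVneq v q; last by exists v; rewrite ?mem_cut_old.
  rewrite vq in mv m'v; have [i mi] := corner_tight C mN mv.
  have [j ji kj] := blunt_other i.
  by exists (a j); rewrite ?mem_cut_vertex // mi na ?cut_vertex_lt // eq_sym.
Qed.

Lemma cut_size_index : (1 < size (cut_index n u k))%N.
Proof.
have [i _ ki] := blunt_other ord0; have [j ji kj] := blunt_other i.
apply: (@uniq_leq_size _ [:: i; j]); first by rewrite /= inE eq_sym ji.
by move=> l; rewrite !inE mem_filter mem_enum => /orP[]/eqP ->; rewrite ?ki ?kj.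
Qed.

Lemma cut_polar : polar V' N'.
Proof.
split.
- exact: cut_uniqV.
- by rewrite /= cut_facet_notin (polar_uniqN VN).
- exact: cut_le.
- exact: cut_hullV.
- exact: cut_hullN.
- exact: cut_extV.
- exact: cut_extN.
- by rewrite size_cat size_map ltn_addr // cut_size_index.
- exact: leqW (polar_sizeN VN).
Qed.

(** At the new vertex [h] takes the place of [n i0], which misses it; the edges lead on to the old
    neighbor [u i0] and to the two other cutting points. *)
Lemma cut_corner i0 : k i0 * g i0 != 1 ->
  corner V' N' (a i0) (fun i => if i == i0 then h else n i)
    (fun i => if i == i0 then u i0 else a i).
Proof.
move=> k0; split=> [|i|i|m|i|i j ij|i].
- exact: mem_cut_vertex.
- by case: eqP; rewrite inE ?eqxx // (corner_n C) orbT.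
- by case: eqP => [_|/eqP ii0]; rewrite ?cut_facet_vertex // na.
- rewrite inE => /orP[/eqP -> _|mN /(cut_vertex_tightP k0 mN)[j ji ->]].
    by exists i0; rewrite eqxx.
  by exists j; rewrite (negPf ji).
- case: eqP => _; last exact: mem_cut_vertex.
  by rewrite mem_cut_old ?corner_neighbor_neq ?(corner_u C).
- have [ii0|ii0] := eqVneq i i0; have [ji0|ji0] := eqVneq j i0.
  + by rewrite ii0 ji0 eqxx in ij.
  + by rewrite cut_facet_vertex.
  + by rewrite (corner_nu C ii0).
  + by rewrite na.
- have [ii0|ii0] := eqVneq i i0; last exact: na_lt.
  have [hle heq] := cut_facet_old (corner_u C i0) (corner_neighbor_neq i0).
  rewrite lt_neqAle hle andbT; apply/eqP => /heq[j /u_inj <- kj].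
  by rewrite kj eqxx in k0.
Qed.

Lemma cut_sizeV : size V' = (size (cut_index n u k) + (size V).-1)%N.
Proof. by rewrite size_cat size_map size_rem ?(corner_q C). Qed.


(** * Adjacencies before and after the cut *)

Let V0 := rem q V.
Let mem_V0 w : (w \in V0) = (w != q) && (w \in V).
Proof. by rewrite (mem_rem_uniq _ (polar_uniqV VN)) inE. Qed.

Let uniq_V0 : uniq V0. Proof. by rewrite rem_uniq ?(polar_uniqV VN). Qed.

Let uniq_N' : uniq N'. Proof. exact: (polar_uniqN cut_polar). Qed.

Let common_line i j l w : i != j -> l != i -> l != j -> w \in V ->
  common q w (n i) -> common q w (n j) -> w = q \/ w = u l.
Proof.
move=> ij li lj wV /andP[_ /eqP iw] /andP[_ /eqP jw].
apply: (polar_colinear_tight VN (corner_n C i) (corner_n C j)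
  (fun E => elimN eqP ij (n_inj E)) (corner_q C) (corner_u C l)) => //.
- exact: corner_neighbor_neq.
- by rewrite /common (corner_nq C) (corner_nu C) ?eqxx // eq_sym.
- by rewrite /common (corner_nq C) (corner_nu C) ?eqxx // eq_sym.
Qed.

(** The new facet contains at most one old vertex, because at most one index is sharp; it is never
    common to two of them. *)
Let adj_old v w : v \in V0 -> w \in V0 -> adj N' v w = adj N v w.
Proof.
rewrite !mem_V0 => /andP[vq vV] /andP[wq wV]; rewrite /adj /=.
have [//|vw] := eqVneq v w; rewrite (_ : common v w h = false) //.
apply/negP => /andP[/eqP hv /eqP hw].
have [_ /(_ hv)[i vi ki]] := cut_facet_old vV vq.
have [_ /(_ hw)[j wj kj]] := cut_facet_old wV wq.
by rewrite vi wj (sharp_uniq ki kj) eqxx in vw.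
Qed.

Let adj_q w : w \in V0 -> adj N q w = (w \in codom u).
Proof.
rewrite mem_V0 => /andP[wq wV]; apply/(adjP _ _ (polar_uniqN VN))/codomP.
  move=> [_ [m [m' [mN m'N mm' mc m'c]]]].
  have [i mi] := corner_tight C mN (eqP (andP mc).1).
  have [j mj] := corner_tight C m'N (eqP (andP m'c).1).
  rewrite mi mj in mm' mc m'c.
  have ij : i != j by apply/eqP => E; rewrite E eqxx in mm'.
  have [l [li lj]] := ord3_third i j.
  have [E|->] := common_line ij li lj wV mc m'c; last by exists l.
  by rewrite E eqxx in wq.
move=> [i wi]; rewrite eq_sym wq; split=> //.
have [j [l [ji li jl]]] := ord3_other i.
exists (n j), (n l); rewrite !(corner_n C) (inj_eq n_inj) /common !(corner_nq C) wi.
by rewrite !(corner_nu C) ?eqxx.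
Qed.

(** The old neighbors of a new vertex: the far end of its own edge, and the sharp vertex, if any,
    joined to it by an edge of the cut facet. *)
Let vertex_neighbors i := [seq u j | j <- enum 'I_3 & (j == i) || (k j * g j == 1)].

Let adj_new_old i w : k i * g i != 1 -> w \in V0 ->
  adj N' (a i) w = (w \in vertex_neighbors i).
Proof.
move=> ki wV0; have := wV0; rewrite mem_V0 => /andP[wq wV].
have tight m : m \in N' -> dot m (a i) = 1 -> m = h \/ exists2 j, j != i & m = n j.
  by rewrite inE => /orP[/eqP ->|mN /(cut_vertex_tightP ki mN)]; [left|right].
have hw : dot h w = 1 -> w \in vertex_neighbors i.
  have [_ heq] := cut_facet_old wV wq; move=> /heq[j -> kj].
  by apply: map_f; rewrite mem_filter kj eqxx orbT mem_enum.
apply/(adjP _ _ uniq_N')/idP.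
  move=> [_ [m [m' [mN m'N mm' /andP[/eqP ma /eqP mw] /andP[/eqP m'a /eqP m'w]]]]].
  have [mh|[j ji mj]] := tight m mN ma; first by apply: hw; rewrite -mh.
  have [mh|[l li ml]] := tight m' m'N m'a; first by apply: hw; rewrite -mh.
  have jl : j != l by apply/eqP => E; rewrite mj ml E eqxx in mm'.
  have [||||E|->] := @common_line j l i w jl _ _ wV.
  - by rewrite eq_sym.
  - by rewrite eq_sym.
  - by rewrite /common (corner_nq C) -mj mw eqxx.
  - by rewrite /common (corner_nq C) -ml m'w eqxx.
  - by rewrite E eqxx in wq.
  - by apply: map_f; rewrite mem_filter eqxx mem_enum.
move=> /mapP[j]; rewrite mem_filter => /andP[jP _] wj.
split; first by apply/eqP => E; have := cut_vertex_notin ki; rewrite E wV.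
have nN l : n l \in N' by rewrite inE (corner_n C) orbT.
have [ji|ji] := eqVneq j i.
  have [l [l' [li l'i ll']]] := ord3_other i.
  exists (n l), (n l'); rewrite !nN (inj_eq n_inj) ll' /common !na // wj ji.
  by rewrite !(corner_nu C) ?eqxx.
rewrite (negPf ji) /= in jP; have [l [li lj]] := ord3_third i j.
exists h, (n l); rewrite mem_head nN /common cut_facet_vertex na // wj (corner_nu C lj).
rewrite -(cut_vertex_sharp (eqP jP)) cut_facet_vertex eqxx; split=> //.
by apply/eqP => E; have := cut_facet_notin; rewrite E (corner_n C).
Qed.

Let adj_new i j : adj N' (a i) (a j) = (i != j).
Proof.
have [->|ij] := eqVneq i j; first by rewrite /adj eqxx.
apply/(adjP _ _ uniq_N'); rewrite (inj_eq cut_vertex_inj); split=> //.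
have [l [li lj]] := ord3_third i j; exists h, (n l).
rewrite mem_head inE (corner_n C) orbT /common !cut_facet_vertex !na // eqxx.
by split=> //; apply/eqP => E; have := cut_facet_notin; rewrite E (corner_n C).
Qed.

Let sum_mem (T : eqType) (s t : seq T) : uniq s -> uniq t -> {subset t <= s} ->
  (\sum_(x <- s) (x \in t) = size t)%N.
Proof.
move=> us ut ts; transitivity (count (mem t) s).
  by rewrite -sum1_count [RHS]big_mkcond; apply: eq_bigr => x _ /=; case: (x \in t).
rewrite -size_filter; apply: perm_size; apply: uniq_perm => // [|x].
  exact: filter_uniq.
by rewrite mem_filter /=; apply/andP/idP => [[]//|xt]; split=> //; apply: ts.
Qed.

Let u_V0 i : u i \in V0. Proof. by rewrite mem_V0 corner_neighbor_neq (corner_u C). Qed.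

Let size_neighbors i : k i * g i != 1 ->
  size (vertex_neighbors i) = (4 - size (cut_index n u k))%N.
Proof.
move=> ki; rewrite size_map !size_filter.
have := count_predC (fun j => k j * g j == 1) (enum 'I_3).
rewrite size_enum_ord; set p := fun j => _ == 1.
have := count_predUI (pred1 i) p (enum 'I_3).
rewrite count_uniq_mem ?enum_uniq // mem_enum (@eq_count _ (predI _ p) pred0); last first.
  by move=> j /=; case: eqP => [->|]; rewrite /p //= (negPf ki).
rewrite count_pred0 addn0 => cU cC.
have -> : count (fun j => (j == i) || (k j * g j == 1)) (enum 'I_3) =
  count (predU (pred1 i) p) (enum 'I_3) by [].
have -> : count (fun j => k j * g j != 1) (enum 'I_3) = count (predC p) (enum 'I_3) by [].
rewrite cU (_ : (i \in 'I_3) = true) //.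
by move: (count p _) (count (predC p) _) cC => x y; lia.
Qed.

Let size_codom_u : size (codom u) = 3.
Proof. by rewrite size_codom card_ord. Qed.

Let sum_adj_q : (\sum_(w <- V0) adj N q w = 3)%N.
Proof.
rewrite -[RHS]size_codom_u -(sum_mem uniq_V0).
- by apply: eq_big_seq => w /adj_q ->.
- exact/injectiveP.
- by move=> w /codomP[i ->]; apply: u_V0.
Qed.

Let sum_adj_new_old i : k i * g i != 1 ->
  (\sum_(w <- V0) adj N' (a i) w = 4 - size (cut_index n u k))%N.
Proof.
move=> ki; rewrite -(size_neighbors ki) -(sum_mem uniq_V0).
- by apply: eq_big_seq => w /(adj_new_old ki) ->.
- by rewrite (map_inj_uniq u_inj) filter_uniq ?enum_uniq.
- by move=> w /mapP[j _ ->]; apply: u_V0.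
Qed.

Let sum_adj_new i : i \in cut_index n u k ->
  (\sum_(j <- cut_index n u k) adj N' (a i) (a j) = (size (cut_index n u k)).-1)%N.
Proof.
move=> iJ; have uJ : uniq (cut_index n u k) by rewrite filter_uniq ?enum_uniq.
rewrite -(size_rem iJ) -(sum_mem uJ).
- by apply: eq_big_seq => j jJ; rewrite adj_new (mem_rem_uniq _ uJ) inE jJ andbT eq_sym.
- exact: rem_uniq.
- by move=> j /mem_rem.
Qed.

Let darts_split (T : eqType) (r : rel T) (s t : seq T) : symmetric r ->
  (\sum_(x <- s ++ t) \sum_(y <- s ++ t) r x y =
   \sum_(x <- s) \sum_(y <- s) r x y + 2 * (\sum_(x <- s) \sum_(y <- t) r x y)
   + \sum_(x <- t) \sum_(y <- t) r x y)%N.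
Proof.
move=> rC; rewrite big_cat /=.
under eq_bigr do rewrite big_cat /=.
under [X in (_ + X)%N]eq_bigr do rewrite big_cat /=.
rewrite !big_split /= [X in (_ + (X + _))%N]exchange_big /=.
under [X in (_ + (X + _))%N]eq_bigr do under eq_bigr do rewrite rC.
by lia.
Qed.

(** Deleting [q] loses 6 darts. The [s] new vertices are pairwise adjacent, and each has 4 - [s] old
    neighbors: its own and the 3 - [s] sharp ones. The 6 stands on the left to avoid truncated
    subtraction. Since [s] is 2 or 3, the number of edges grows by [s]. *)
Lemma cut_darts : let s := size (cut_index n u k) in
  (darts V' N' + 6 = darts V N + s * s.-1 + 2 * (s * (4 - s)))%N.
Proof.
move=> s; have -> : darts V N = (6 + \sum_(v <- V0) \sum_(w <- V0) adj N v w)%N.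
  have pV : perm_eq V ([:: q] ++ V0) by rewrite perm_to_rem ?(corner_q C).
  rewrite /darts (perm_big _ pV); under eq_bigr do rewrite (perm_big _ pV).
  rewrite darts_split; last exact: adjC.
  by rewrite !big_seq1 sum_adj_q /adj eqxx.
rewrite /darts darts_split; last exact: adjC.
rewrite !big_map; under eq_bigr do rewrite big_map.
have const (F : 'I_3 -> nat) c : (forall i, i \in cut_index n u k -> F i = c) ->
    (\sum_(i <- cut_index n u k) F i = s * c)%N.
  by move=> Fc; rewrite (eq_big_seq _ Fc) big_const_seq count_predT iter_addn_0 mulnC.
rewrite (const _ _ sum_adj_new) (const _ (4 - s)%N) => [|i]; last first.
  by rewrite mem_filter => /andP[ki _]; apply: sum_adj_new_old.
have -> : (\sum_(v <- V0) \sum_(w <- V0) adj N' v w =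
   \sum_(v <- V0) \sum_(w <- V0) adj N v w)%N.
  by apply: eq_big_seq => v vV; apply: eq_big_seq => w wV; rewrite adj_old.
rewrite -/s; lia.
Qed.

End Cut.

(** * Persistence of the equilibria *)

(* Applied to the vertices this says that only [x] is an unstable equilibrium, applied to
   the facet normals that only [x] carries a stable one. All inequalities are strict, to
   survive small perturbations. *)
Definition sole_equilibrium (R : realType) (L : seq (point R)) (x : point R) : Prop :=
  [/\ x \in L, forall y, y \in L -> y != x -> dot y x < dot x x &
    forall y, y \in L -> y != x -> exists2 w, w \in L & dot y y < dot y w].

(** * Strict inequalities for all large parameters *)

Section Eventually.
Variable R : realType.
Implicit Types (P Q : R -> Prop) (A B C : R).

Definition eventually P := exists T0, forall T, T0 <= T -> P T.

Lemma eventually_and P Q : eventually P -> eventually Q -> eventually (fun T => P T /\ Q T).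
Proof.
move=> [T1 h1] [T2 h2]; exists (Num.max T1 T2) => T.
by rewrite ge_max => /andP[/h1 ? /h2].
Qed.

Lemma eventually_mono P Q : (forall T, P T -> Q T) -> eventually P -> eventually Q.
Proof. by move=> PQ [T0 h]; exists T0 => T /h /PQ. Qed.

Lemma eventually_all (I : eqType) (s : seq I) (P : I -> R -> Prop) :
  (forall i, i \in s -> eventually (P i)) -> eventually (fun T => forall i, i \in s -> P i T).
Proof.
elim: s => [|i s IH] ev; first by exists 0.
have evi : eventually (P i) by apply: ev; apply: mem_head.
have evs : eventually (fun T => forall j, j \in s -> P j T).
  by apply: IH => j js; apply: ev; rewrite inE js orbT.
apply: eventually_mono (eventually_and evi evs) => T [Pi Ps] j.
by rewrite inE => /predU1P[-> //|/Ps].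
Qed.

Lemma eventually_gt A : eventually (fun T => A < T).
Proof. by exists (A + 1) => T; lra. Qed.

Lemma eventually_affine P A B : 0 < A -> eventually P -> eventually (fun T => P (T * A + B)).
Proof.
move=> A0 [T0 h]; exists ((T0 - B) / A) => T.
by rewrite ler_pdivrMr // => le; apply: h; lra.
Qed.

(** In the inverse of the cut parameter, each inequality to be kept is a polynomial of degree at
    most two whose constant term is the strict inequality at the limit [q] or [n i0]. *)
Lemma eventually_quad A B C : 0 < A ->
  eventually (fun T => 0 < A + T^-1 * B + T^-1 * (T^-1 * C)).
Proof.
move=> A0; have [T0 h] := eventually_and (eventually_gt 1) (eventually_gt ((`|B| + `|C|) / A)).
exists T0 => T /h[T1]; rewrite ltr_pdivrMr // => TA.
have T_gt0 : 0 < T by apply: lt_trans T1.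
set r := T^-1; have r0 : 0 < r by rewrite invr_gt0.
have rT : r * T = 1 by rewrite mulVf // gt_eqF.
have r1 : r < 1 by rewrite invf_lt1.
have : r * (`|B| + `|C|) < A.
  by rewrite -(ltr_pM2l T_gt0) mulrA [T * r]mulrC rT mul1r.
have : - `|B| <= B by rewrite lerNl -normrN ler_norm.
have : - `|C| <= C by rewrite lerNl -normrN ler_norm.
have : 0 <= `|C| by [].
move: `|B| `|C| => b c c0 cC bB lt.
have rC : 0 <= r * C + c by nra.
have : 0 <= r * (r * C + c) by rewrite mulr_ge0 // ltW.
have : r * B >= - (r * b) by nra.
lra.
Qed.

End Eventually.

Section Step.
Variables (R : realType) (V N : seq (point R)) (q vs ns : point R).
Variables (n u : 'I_3 -> point R) (i0 : 'I_3).
Hypotheses (VN : polar V N) (C : corner V N q n u).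
Hypotheses (Vs : sole_equilibrium V vs) (Ns : sole_equilibrium N ns).
Hypotheses (qvs : q != vs) (nns : n i0 != ns).

Local Notation g := (gap n u).
(** The cutting point for [k i = T]; it tends to [q] as [T] grows. *)
Let a i T := q + (T * g i)^-1 *: (u i - q).

Let g_gt0 i : 0 < g i. Proof. exact: gap_gt0 C i. Qed.

(** The witness against [q] differs from [q], hence survives its removal, and by continuity it
    serves for every point close to [q]. *)
Let vertex_not_equilibrium : exists w, [/\ w \in V, w != q & forall i,
  eventually (fun T => dot (a i T) (a i T) < dot (a i T) w)].
Proof.
have [_ _ /(_ q (corner_q C) qvs)[w wV qw]] := Vs; exists w; split=> [//||i].
  by apply: contraTneq qw => ->; rewrite ltxx.
have := @eventually_quad R (dot q w - dot q q) (dot (u i - q) w - 2 * dot q (u i - q))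
  (- dot (u i - q) (u i - q)).
rewrite subr_gt0 => /(_ qw) /(eventually_affine 0 (g_gt0 i)).
apply: eventually_mono => T lt; rewrite /a -subr_gt0; move: lt; rewrite addr0.
set r := _^-1.
move: (u i - q) => d; rewrite !dotlin (dotC d q); congr (_ < _); ring.
Qed.

(** For the old vertices whose witness was [q], which disappears. *)
Let vertex_replaces : eventually (fun T => forall v, v \in V ->
  dot v v < dot v q -> dot v v < dot v (a i0 T)).
Proof.
apply: eventually_all => v vV; have [lt|ge] := boolP (dot v v < dot v q); last first.
  by exists 0.
have := @eventually_quad R (dot v q - dot v v) (dot v (u i0 - q)) 0.
rewrite subr_gt0 => /(_ lt) /(eventually_affine 0 (g_gt0 i0)).
apply: eventually_mono => T gt0 _; rewrite /a -subr_gt0; move: gt0; rewrite addr0.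
set r := _^-1.
move: (u i0 - q) => d; rewrite !dotlin; congr (_ < _); ring.
Qed.

(** With the other two weights fixed, the weight of [n i0] dominates the normalized sum as [T]
    grows, so the cutting plane becomes almost parallel to the facet [n i0]. *)
Let facet_near (k : 'I_3 -> R) : exists r, forall T,
  T + \sum_(i | i != i0) k i != 1 ->
  cut_facet n (fun i => if i == i0 then T else k i) =
  n i0 + (T + (\sum_(i | i != i0) k i - 1))^-1 *: r.
Proof.
set c := \sum_(i | _) _.
exists (\sum_(i | i != i0) k i *: n i - (c - 1) *: n i0) => T Tc.
have KE : \sum_i (if i == i0 then T else k i) = T + c.
  by rewrite (bigD1 i0) //= eqxx; congr (_ + _); apply: eq_bigr => i /negPf ->.
rewrite /cut_facet KE (bigD1 i0) //= eqxx.
under eq_bigr => i /negPf ni do rewrite ni.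
move: (\sum_(i | _) _) => S; rewrite [T + (c - 1)]addrA.
apply/rowP => j; rewrite !mxE; field.
by rewrite subr_eq0.
Qed.

(** Both properties hold for [n i0], and the new normal is close to it. The first keeps [ns] an
    equilibrium, the second prevents a new one. *)
Let facet_eventually (k : 'I_3 -> R) :
  eventually (fun T => let h := cut_facet n (fun i => if i == i0 then T else k i) in
    dot h ns < dot ns ns /\ exists2 w, w \in N & dot h h < dot h w).
Proof.
have [nsN nslt /(_ _ (corner_n C i0) nns)[w wN nw]] := Ns.
have [r hr] := facet_near k; move: hr; set c := \sum_(i | _) _ => hr.
have ev1 := @eventually_quad R (dot ns ns - dot (n i0) ns) (- dot r ns) 0.
have ev2 := @eventually_quad R (dot (n i0) w - dot (n i0) (n i0))
  (dot r w - 2 * dot (n i0) r) (- dot r r).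
rewrite !subr_gt0 in ev1 ev2.
have {}ev1 := eventually_affine (c - 1) ltr01 (ev1 (nslt _ (corner_n C i0) nns)).
have {}ev2 := eventually_affine (c - 1) ltr01 (ev2 nw).
apply: eventually_mono (eventually_and (eventually_gt (1 - c)) (eventually_and ev1 ev2)).
move=> T [Tc]; rewrite mulr1 hr; last by rewrite gt_eqF //; lra.
move: (_^-1) => s [h1 h2]; split; [|exists w => //]; rewrite !dotlin ?(dotC r (n i0)); lra.
Qed.

Lemma cut_step (b : bool) : exists k : 'I_3 -> R,
  [/\ forall i, 1 <= k i * g i,
      forall i j, i != j -> k i * g i = 1 -> 1 < k j * g j,
      1 < \sum_i k i, k i0 * g i0 != 1 &
   [/\ size (cut_index n u k) = if b then 2 else 3,
      sole_equilibrium (cut_vertices V q n u k) vs &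
      sole_equilibrium (cut_facets N n k) ns]].
Proof.
have [w [wV wq ev_w]] := vertex_not_equilibrium.
(* If [b] holds, the plane goes through [u i1]. The index differs from [i0], since the next corner
   must be a new vertex inside the edge towards [u i0]. *)
have [i1 [_ [i10 _ _]]] := ord3_other i0.
have [T1 hT1] : exists T1, forall i, 1 < T1 * g i /\ dot (a i T1) (a i T1) < dot (a i T1) w.
  have [T1 h] : eventually (fun T => forall i, i \in enum 'I_3 ->
      1 < T * g i /\ dot (a i T) (a i T) < dot (a i T) w).
    apply: eventually_all => i _; apply: eventually_and => //.
    apply: eventually_mono (eventually_gt (g i)^-1) => T.
    by rewrite -ltr_pdivrMr ?g_gt0 // div1r.
  by exists T1 => i; apply: h; rewrite ?mem_enum.
pose k i := if b && (i == i1) then (g i)^-1 else T1.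
(* The other weights are frozen before [T] is chosen, because how large [T] must be for the new
   facet depends on them. *)
have [T [[T_gt1 Tg] [Tw [Trep [Tns Tn]]]]] : exists T, (1 < T /\ 1 < T * g i0) /\
   (dot (a i0 T) (a i0 T) < dot (a i0 T) w /\
   ((forall v, v \in V -> dot v v < dot v q -> dot v v < dot v (a i0 T)) /\
   (let h := cut_facet n (fun i => if i == i0 then T else k i) in
    dot h ns < dot ns ns /\ exists2 w, w \in N & dot h h < dot h w))).
  have ev1 : eventually (fun T => 1 < T /\ 1 < T * g i0).
    apply: eventually_and; first exact: eventually_gt.
    apply: eventually_mono (eventually_gt (g i0)^-1) => T.
    by rewrite -ltr_pdivrMr ?g_gt0 // div1r.
  have [T h] := eventually_and ev1 (eventually_and (ev_w i0)
    (eventually_and vertex_replaces (facet_eventually k))).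
  by exists T; apply: h.
pose k' i := if i == i0 then T else k i.
have sharpE i : (k' i * g i == 1) = b && (i == i1).
  rewrite /k' /k; case: (eqVneq i i0) => [->|_].
    by rewrite (gt_eqF Tg) eq_sym (negPf i10) andbF.
  case: ifP => _; first by rewrite mulVf ?eqxx // gt_eqF.
  by rewrite gt_eqF //; case: (hT1 i).
have k_ge i : 1 <= k' i * g i.
  rewrite /k' /k; case: (eqVneq i i0) => [->|_]; first exact: ltW.
  case: ifP => _; first by rewrite mulVf // gt_eqF.
  by case: (hT1 i) => /ltW.
have k_blunt i : k' i * g i != 1 -> 1 < k' i * g i by rewrite lt_neqAle eq_sym k_ge => ->.
have k_gt i j : i != j -> k' i * g i = 1 -> 1 < k' j * g j.
  move=> ij /eqP; rewrite sharpE => /andP[bT /eqP i_i1]; apply: k_blunt.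
  by rewrite sharpE bT /= eq_sym -i_i1.
have k_gt0 i : 0 < k' i.
  by rewrite -(pmulr_lgt0 _ (g_gt0 i)); apply: lt_le_trans (k_ge i).
have K_gt1 : 1 < \sum_i k' i.
  rewrite (bigD1 i0) //= /k' eqxx.
  have : 0 <= \sum_(i < 3 | i != i0) k' i by apply: sumr_ge0 => i _; apply: ltW.
  rewrite /k'; lra.
have k0 : k' i0 * g i0 != 1 by rewrite sharpE eq_sym (negPf i10) andbF.
have aw i : k' i * g i != 1 ->
    dot (cut_vertex q n u k' i) (cut_vertex q n u k' i) < dot (cut_vertex q n u k' i) w.
  rewrite sharpE /cut_vertex /k' /k; case: (eqVneq i i0) => [-> //|_].
  by move/negPf ->; case: (hT1 i).
exists k'; split=> //; split.
- have -> : size (cut_index n u k') =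
      count (predC (fun i => k' i * g i == 1)) (enum 'I_3) by rewrite size_filter.
  have := count_predC (fun i => k' i * g i == 1) (enum 'I_3).
  have -> : count (fun i => k' i * g i == 1) (enum 'I_3) = b.
    rewrite (eq_count sharpE); case: (b); last by rewrite count_pred0.
    by rewrite (@eq_count _ _ (pred1 i1)) // count_uniq_mem ?enum_uniq // mem_enum.
  by rewrite size_enum_ord; move: (count _ _) => c; case: (b); lia.
- have [vsV vslt vsw] := Vs; split.
  + by apply: (mem_cut_old _ _ _ VN) => //; rewrite eq_sym.
  + move=> y /(cutP VN)[[i ki ->] _|[yV yq]]; last exact: vslt.
    (* A new vertex mixes [u i], which may be [vs] itself, with a positive weight of [q], where the
       inequality is strict. *)
    have r1 := cut_ratio_lt1 k_ge ki; have /andP[r0 _] := cut_ratio k_ge i.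
    rewrite cut_vertex_mix !dotlin; have qlt := vslt _ (corner_q C) qvs.
    have ule : dot (u i) vs <= dot vs vs.
      have [->//|uvs] := eqVneq (u i) vs; exact: ltW (vslt _ (corner_u C i) uvs).
    by move: (_^-1) r0 r1 => r r0 r1; nra.
  + move=> y /(cutP VN)[[i ki ->] _|[yV yq] yvs].
      by exists w; [apply: (mem_cut_old _ _ _ VN) | apply: aw].
    have [z zV yz] := vsw y yV yvs.
    have [zq|zq] := eqVneq z q; last by exists z => //; apply: (mem_cut_old _ _ _ VN).
    exists (cut_vertex q n u k' i0); first exact: (mem_cut_vertex _ VN C).
    by rewrite /cut_vertex /k' eqxx; apply: Trep => //; rewrite -zq.
- have [nsN nslt nsw] := Ns; split.
  + by rewrite inE nsN orbT.
  + by move=> y; rewrite inE => /orP[/eqP -> _ //|]; apply: nslt.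
  + move=> y; rewrite inE => /orP[/eqP -> _|yN yns].
      by have [z zN hz] := Tn; exists z; rewrite // inE zN orbT.
    by have [z zN yz] := nsw y yN yns; exists z; rewrite // inE zN orbT.
Qed.

End Step.

(** The invariant of the induction. The equation on darts is e = f + v - 2 doubled; the corner, with
    [q] and [n i0] not in equilibrium, is the site of the next cut. *)
Definition mono_state (R : realType) (f v : nat) : Prop :=
  exists (V N : seq (point R)) (q vs ns : point R) (n u : 'I_3 -> point R) (i0 : 'I_3),
    [/\ polar V N, size N = f, size V = v & (darts V N + 4 = 2 * (f + v))%N] /\
    [/\ sole_equilibrium V vs, sole_equilibrium N ns, corner V N q n u, q != vs & n i0 != ns].

Lemma mono_state_step (R : realType) (b : bool) f v :
  mono_state R f v -> mono_state R f.+1 (v + (if b then 1 else 2))%N.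
Proof.
move=> [V [N [q [vs [ns [n [u [i0 [[VN sN sV dVN] [Vs Ns C qvs nns]]]]]]]]]].
have [k [k_ge k_gt K_gt1 k0 [sJ Vs' Ns']]] := cut_step VN C Vs Ns qvs nns b.
exists (cut_vertices V q n u k), (cut_facets N n k), (cut_vertex q n u k i0), vs, ns.
exists (fun i => if i == i0 then cut_facet n k else n i).
exists (fun i => if i == i0 then u i0 else cut_vertex q n u k i), i0.
have vV : (0 < size V)%N by rewrite (ltn_trans _ (polar_sizeV VN)).
split; split=> //.
- exact: (cut_polar VN C).
- by rewrite /= sN.
- rewrite (cut_sizeV _ C) sJ sV; rewrite sV in vV; case: (b); lia.
- have := cut_darts VN C k_ge k_gt K_gt1; rewrite sJ /= => d.
  by move: d dVN; case: (b); lia.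
- exact: (cut_corner VN C).
- apply/eqP => E; have := cut_vertex_notin VN C k_ge k0.
  by rewrite E; have [-> ] := Vs.
- rewrite eqxx; apply/eqP => E; have := cut_facet_notin VN C K_gt1.
  by rewrite E; have [-> ] := Ns.
Qed.

(** * Tetrahedra and the initial polyhedra *)

Section SimplexPolar.
Variables (R : realType) (F W : 'I_4 -> point R).
Hypothesis FW : forall i j, i != j -> dot (F i) (W j) = 1.
Hypothesis FW_lt : forall i, dot (F i) (W i) < 1.
Hypothesis hullW : forall x, (forall i, dot (F i) x <= 1) -> hull (codom W) x.
Hypothesis hullF : forall y, (forall i, dot y (W i) <= 1) -> hull (codom F) y.

Let W_inj : injective W.
Proof.
move=> i j E; apply/eqP; apply: contraT => ij; have := FW_lt i.
by rewrite E (FW ij) ltxx.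
Qed.

Let F_inj : injective F.
Proof.
move=> i j E; apply/eqP; apply: contraT => ij; have := FW_lt j.
by rewrite -E (FW ij) ltxx.
Qed.

Lemma simplex_polar : polar (codom W) (codom F).
Proof.
split.
- exact/injectiveP.
- exact/injectiveP.
- move=> _ _ /codomP[i ->] /codomP[j ->].
  by have [->|/FW ->//] := eqVneq i j; apply: ltW.
- by move=> x le; apply: hullW => i; apply: le; apply: codom_f.
- by move=> y le; apply: hullF => i; apply: le; apply: codom_f.
- move=> _ _ /codomP[i ->] /codomP[j ->] /eqP; rewrite (inj_eq W_inj) => ij.
  by exists (F j); rewrite ?codom_f // FW // eq_sym.
- move=> _ _ /codomP[i ->] /codomP[j ->] /eqP; rewrite (inj_eq F_inj) => ij.
  by exists (W j); rewrite ?codom_f // FW.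
- by rewrite size_codom card_ord.
- by rewrite size_codom card_ord.
Qed.

(** Any two vertices lie on the two facets opposite to the remaining two, so all 4 * 3 ordered pairs
    count. *)
Lemma simplex_darts : darts (codom W) (codom F) = 12%N.
Proof.
have adjE i j : adj (codom F) (W i) (W j) = (i != j).
  have [->|ij] := eqVneq i j; first by rewrite /adj eqxx.
  apply/(adjP _ _ (polar_uniqN simplex_polar)); rewrite (inj_eq W_inj); split=> //.
  have [k [l [kl [ki kj] [li lj]]]] : exists k l : 'I_4,
      [/\ k != l, k != i /\ k != j & l != i /\ l != j].
    have : (1 < #|~: [set i; j]|)%N by rewrite cardsCs setCK card_ord cards2 ij.
    case/card_gt1P => k [l []]; rewrite !inE !negb_or => /andP[] ? ? /andP[] ? ? ?.
    by exists k, l.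
  exists (F k), (F l); rewrite !codom_f (inj_eq F_inj) kl /common !FW // eqxx.
  by [].
rewrite /darts /codom /image_mem big_map.
under eq_bigr do [rewrite big_map; under eq_bigr do rewrite adjE].
rewrite big_enum; under eq_bigr do rewrite big_enum.
by rewrite !big_ord_recl !big_ord0.
Qed.

End SimplexPolar.

Section Tetrahedron.
Variables (R : realType) (n e : 'I_3 -> point R) (l : 'I_3 -> R).
Hypothesis ne : forall i j, dot (n i) (e j) = (i == j)%:R.
Hypothesis l_gt0 : forall i, 0 < l i.
Hypothesis l_lt1 : \sum_i l i < 1.

Local Notation L := (\sum_i l i).
Definition tetra_apex : point R := \sum_i e i.
(** The origin has barycentric coordinates [l i] at these points and [1 - L] at the apex, so the
    hypotheses on [l] put it in the interior. *)
Definition tetra_vertex i : point R := tetra_apex - (l i)^-1 *: e i.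
(* Chosen such that [\sum_i l i *: n i + (1 - \sum_i l i) *: tetra_base = 0]. *)
Definition tetra_base : point R := (L - 1)^-1 *: \sum_i l i *: n i.
Local Notation q := tetra_apex.
Local Notation u := tetra_vertex.
Local Notation m := tetra_base.
Let F := ord_cons m n.
Let W := ord_cons q u.

Let l_n0 i : l i != 0. Proof. by rewrite gt_eqF. Qed.
Let L1 : 0 < 1 - L. Proof. by rewrite subr_gt0. Qed.
Let L1n : L - 1 != 0. Proof. by rewrite subr_eq0 lt_eqF. Qed.

Let nq i : dot (n i) q = 1.
Proof.
rewrite dot_sumr (bigD1 i) //= ne eqxx big1 ?addr0 // => j ji.
by rewrite ne eq_sym (negPf ji).
Qed.

Let nu i j : dot (n i) (u j) = 1 - (l j)^-1 * (i == j)%:R.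
Proof. by rewrite dotDr dotNr dotZr nq ne. Qed.

Let mq : dot m q = 1 + (L - 1)^-1.
Proof.
have -> : dot m q = (L - 1)^-1 * L.
  rewrite dotZl dot_suml; congr (_ * _).
  by apply: eq_bigr => i _; rewrite dotZl nq mulr1.
by field.
Qed.

Let me i : dot m (e i) = (L - 1)^-1 * l i.
Proof.
rewrite dotZl dot_suml; congr (_ * _).
rewrite (bigD1 i) //= big1 ?addr0 => [|j ji].
  by rewrite dotZl ne eqxx mulr1.
by rewrite dotZl ne (negPf ji) mulr0.
Qed.

Let mu i : dot m (u i) = 1.
Proof. by rewrite dotDr dotNr dotZr mq me; field; rewrite ?l_n0 ?L1n. Qed.

Lemma tetra_gap i : gap n u i = (l i)^-1.
Proof. by rewrite /gap nu eqxx mulr1 subKr. Qed.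

Let FW i j : i != j -> dot (F i) (W j) = 1.
Proof.
rewrite /F /W /ord_cons; elim/ord_consP: i; elim/ord_consP: j.
- by rewrite eqxx.
- by move=> j _; rewrite unlift_none liftK mu.
- by move=> i _; rewrite unlift_none liftK nq.
- move=> j i; rewrite (inj_eq (lift_inj (h:=ord0))) !liftK nu => /negPf ->.
  by rewrite mulr0 subr0.
Qed.

Let FW_lt i : dot (F i) (W i) < 1.
Proof.
rewrite /F /W /ord_cons; elim/ord_consP: i => [|i].
  by rewrite unlift_none mq gtrDl invr_lt0 subr_lt0.
by rewrite liftK nu eqxx mulr1 -subr_gt0 subKr invr_gt0.
Qed.

(** The slacks of [x] at the four facets, weighted by [1 - L] and the [l i], sum to 1 because the
    normals with these weights sum to 0; they are the barycentric coordinates of [x]. *)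
Let hullW x : (forall i, dot (F i) x <= 1) -> hull (codom W) x.
Proof.
move=> le; have mx := le ord0; have nx i := le (lift ord0 i).
rewrite /F /ord_cons unlift_none in mx.
have {}nx i : dot (n i) x <= 1 by have := nx i; rewrite /F /ord_cons liftK.
have mxE : dot m x = (L - 1)^-1 * \sum_i l i * dot (n i) x.
  by rewrite dotZl dot_suml; congr (_ * _); apply: eq_bigr => i _; rewrite dotZl.
have sumn : \sum_i l i * (1 - dot (n i) x) = L - \sum_i l i * dot (n i) x.
  by rewrite -sumrB; apply: eq_bigr => i _; rewrite mulrBr mulr1.
have w1 : (1 - L) * (1 - dot m x) + \sum_i l i * (1 - dot (n i) x) = 1.
  by rewrite sumn mxE; field.
have -> : x = ((1 - L) * (1 - dot m x)) *: q + \sum_i (l i * (1 - dot (n i) x)) *: u i.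
  under [X in _ + X]eq_bigr do rewrite /tetra_vertex scalerBr.
  rewrite sumrB -scaler_suml addrA -scalerDl w1 scale1r /tetra_apex.
  rewrite {1}((biorthogonal ne).1 x) -sumrB; apply: eq_bigr => i _.
  rewrite scalerA mulrAC mulfV // mul1r scalerBl scale1r.
  by rewrite opprB addrC subrK.
apply: hull_sum_cons => // [|i||i].
- by rewrite mulr_ge0 ?(ltW L1) // subr_ge0.
- by rewrite mulr_ge0 ?(ltW (l_gt0 i)) // subr_ge0.
- by apply: hull_in; rewrite codom_ord_cons mem_head.
- by apply: hull_in; rewrite codom_ord_cons inE codom_f orbT.
Qed.

(** Polar counterpart: the slacks of [y] at the four vertices, with the same weights, are its
    coefficients in the four normals. *)
Let hullF y : (forall i, dot y (W i) <= 1) -> hull (codom F) y.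
Proof.
move=> le; have yq := le ord0; have yu i := le (lift ord0 i).
rewrite /W /ord_cons unlift_none in yq.
have {}yu i : dot y (u i) <= 1 by have := yu i; rewrite /W /ord_cons liftK.
have yuE i : dot y (u i) = dot y q - (l i)^-1 * dot y (e i).
  by rewrite dotDr dotNr dotZr.
have luE i : l i * (1 - dot y (u i)) = l i * (1 - dot y q) + dot y (e i).
  by rewrite yuE; field.
have -> : y = ((1 - L) * (1 - dot y q)) *: m + \sum_i (l i * (1 - dot y (u i))) *: n i.
  under [X in _ + X]eq_bigr do rewrite luE scalerDl mulrC -scalerA.
  rewrite big_split /= -scaler_sumr -((biorthogonal ne).2 y) /tetra_base.
  rewrite scalerA; have -> : (1 - L) * (1 - dot y q) / (L - 1) = - (1 - dot y q) by field.
  by rewrite scaleNr addrA addNr add0r.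
apply: hull_sum_cons => [|i|||i].
- by rewrite mulr_ge0 ?(ltW L1) // subr_ge0.
- by rewrite mulr_ge0 ?(ltW (l_gt0 i)) // subr_ge0.
- under [X in _ + X]eq_bigr do rewrite luE.
  by rewrite big_split /= -mulr_suml -dot_sumr; ring.
- by apply: hull_in; rewrite codom_ord_cons mem_head.
- by apply: hull_in; rewrite codom_ord_cons inE codom_f orbT.
Qed.

Lemma tetra_polar : polar (q :: codom u) (m :: codom n).
Proof. by rewrite -!codom_ord_cons; apply: simplex_polar. Qed.

Lemma tetra_darts : darts (q :: codom u) (m :: codom n) = 12%N.
Proof. by rewrite -!codom_ord_cons; apply: simplex_darts. Qed.

Lemma tetra_corner : corner (q :: codom u) (m :: codom n) q n u.
Proof.
split=> [|i|i|a|i|i j ij|i] //.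
- exact: mem_head.
- by rewrite inE codom_f orbT.
- rewrite inE => /orP[/eqP ->|/codomP[i ->] _]; last by exists i.
  by have := FW_lt ord0; rewrite /F /W /ord_cons !unlift_none => lt E; rewrite E ltxx in lt.
- by rewrite inE codom_f orbT.
- by rewrite nu (negPf ij) mulr0 subr0.
- by rewrite -subr_gt0 -/(gap n u i) tetra_gap invr_gt0.
Qed.

End Tetrahedron.

Definition pt (R : realType) (a b c : R) : point R := \row_(i < 3) [:: a; b; c]`_i.

Lemma dot_pt (R : realType) (a b c a' b' c' : R) :
  dot (pt a b c) (pt a' b' c') = a * a' + b * b' + c * c'.
Proof. by rewrite dotE !mxE. Qed.

Lemma ptD (R : realType) (a b c a' b' c' : R) :
  pt a b c + pt a' b' c' = pt (a + a') (b + b') (c + c').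
Proof. by apply/rowP => -[[|[|[|//]]] ?]; rewrite !mxE. Qed.

Lemma ptZ (R : realType) (t a b c : R) : t *: pt a b c = pt (t * a) (t * b) (t * c).
Proof. by apply/rowP => -[[|[|[|//]]] ?]; rewrite !mxE. Qed.

Lemma ptN (R : realType) (a b c : R) : - pt a b c = pt (- a) (- b) (- c).
Proof. by apply/rowP => -[[|[|[|//]]] ?]; rewrite !mxE. Qed.

Definition tri (T : Type) (a b c : T) (i : 'I_3) : T :=
  match val i with 0%N => a | 1%N => b | _ => c end.

Lemma tri_ind (P : 'I_3 -> Prop) :
  P ord0 -> P (lift ord0 ord0) -> P (lift ord0 (lift ord0 ord0)) -> forall i, P i.
Proof.
by move=> P0 P1 P2; elim/ord_consP => // i; elim/ord_consP: i => // i; elim/ord_consP: i => // -[].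
Qed.

Lemma sum_tri (A : zmodType) (F : 'I_3 -> A) :
  \sum_i F i = F ord0 + F (lift ord0 ord0) + F (lift ord0 (lift ord0 ord0)).
Proof. by rewrite !big_ord_recl big_ord0 addr0 addrA. Qed.

Lemma sole_equilibrium_all (R : realType) (L : seq (point R)) x : x \in L ->
  all (fun y => (y == x) || (dot y x < dot x x) && has (fun w => dot y y < dot y w) L) L ->
  sole_equilibrium L x.
Proof.
move=> xL /allP h; split=> // y yL yx; have := h y yL; rewrite (negPf yx) /= => /andP[] //.
by move=> _ /hasP[w wL yw]; exists w.
Qed.

(** As [gap n u i] is the inverse of [l i], the conditions on the cut become comparisons of [k] with
    [l]. The facet for the next cut has its own index [j0], because the facet at index [i0] of the
    new corner is the cut facet, which may be the stable one. *)
Lemma tetra_cut_state (R : realType) (n e : 'I_3 -> point R) (l k : 'I_3 -> R)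
    (LV LN : seq (point R)) (vs ns : point R) (i0 j0 : 'I_3) :
  (forall i j, dot (n i) (e j) = (i == j)%:R) ->
  (forall i, 0 < l i) -> \sum_i l i < 1 ->
  (forall i, l i <= k i) -> (forall i j, i != j -> k i = l i -> l j < k j) ->
  1 < \sum_i k i -> k i0 != l i0 ->
  [seq tetra_apex e - (k i)^-1 *: e i | i <- enum 'I_3 & k i != l i] ++
    codom (tetra_vertex e l) = LV ->
  (cut_facet n k :: tetra_base n l :: codom n) = LN ->
  sole_equilibrium LV vs -> sole_equilibrium LN ns ->
  tetra_apex e - (k i0)^-1 *: e i0 != vs ->
  (if j0 == i0 then cut_facet n k else n j0) != ns ->
  mono_state R 5 (size LV).
Proof.
move=> ne l0 l1 kl kl' K1 k0 VE NE Vs Ns avs nns.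
have P := tetra_polar ne l0 l1; have C := tetra_corner ne l0 l1.
set q := tetra_apex e in VE avs P C *; set u := tetra_vertex e l in VE P C *.
have gE := tetra_gap l ne; rewrite -/u in gE.
have sharpE i : (k i * gap n u i == 1) = (k i == l i).
  by rewrite gE (can2_eq (divfK (lt0r_neq0 (l0 i))) (mulfK (lt0r_neq0 (l0 i)))) mul1r.
have k_ge i : 1 <= k i * gap n u i by rewrite gE ler_pdivlMr // mul1r.
have k_gt i j : i != j -> k i * gap n u i = 1 -> 1 < k j * gap n u j.
  move=> ij /eqP; rewrite sharpE gE ltr_pdivlMr // mul1r => /eqP; exact: kl'.
have aE i : cut_vertex q n u k i = q - (k i)^-1 *: e i.
  have k_gt0 : k i != 0 by rewrite gt_eqF // (lt_le_trans (l0 i)).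
  have -> : cut_vertex q n u k i = q + (k i / l i)^-1 *: - ((l i)^-1 *: e i).
    by rewrite /cut_vertex gE /u /tetra_vertex -/q addrAC subrr add0r.
  rewrite scalerN scalerA; congr (_ - _ *: _); field.
  by rewrite k_gt0 gt_eqF.
have V'E : cut_vertices (q :: codom u) q n u k = LV.
  rewrite -VE /cut_vertices /= eqxx /cut_index (eq_filter (a2 := fun i => k i != l i)).
    by congr (_ ++ _); apply: eq_map.
  by move=> i; rewrite sharpE.
have sV := cut_sizeV k C; rewrite V'E /= size_codom card_ord in sV.
exists LV, LN, (cut_vertex q n u k i0), vs, ns.
exists (fun i => if i == i0 then cut_facet n k else n i).
exists (fun i => if i == i0 then u i0 else cut_vertex q n u k i), j0.
split; split=> //.
- by rewrite -V'E -NE; apply: (cut_polar P C).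
- by rewrite -NE /= size_codom card_ord.
- have := cut_darts P C k_ge k_gt K1; rewrite V'E /cut_facets NE (tetra_darts ne l0 l1) sV.
  have : (size (cut_index n u k) <= 3)%N.
    by rewrite /cut_index size_filter (leq_trans (count_size _ _)) // size_enum_ord.
  have := cut_size_index k_gt.
  by case: (size _) => [|[|[|[|]]]] //= _ _; lia.
- by rewrite -V'E -NE; apply: (cut_corner P C) => //; rewrite sharpE.
- by rewrite aE.
Qed.

Lemma enum_ord3 : enum 'I_3 = [:: ord0; lift ord0 ord0; lift ord0 (lift ord0 ord0)].
Proof. by apply: (inj_map val_inj); rewrite val_enum_ord. Qed.

Ltac pt_simpl := rewrite ?(ptZ, ptN, ptD).

Ltac sole_pt := rewrite /=; repeat (apply/andP; split; [
  first [ by rewrite eqxx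
        | apply/orP; right; apply/andP; split; [by rewrite !dot_pt; lra |];
          repeat first [ apply/orP; left; rewrite !dot_pt; lra | apply/orP; right ] ] |]).

Ltac pt_neq := apply/eqP => /(congr1 (fun y => dot y y)); pt_simpl; rewrite !dot_pt; lra.

(* The coordinates in the next two proofs were found by a random search. *)
Lemma mono_state55 (R : realType) : mono_state R 5 5.
Proof.
pose n := tri (pt (-1) (-3) 0) (pt 1 4 5) (pt (-2) 0 (-2)) : 'I_3 -> point R.
pose e := tri (pt (-1/4) (-1/4) (1/4)) (pt (-3/16) (1/16) (3/16))
  (pt (-15/32) (5/32) (-1/32)) : 'I_3 -> point R.
pose l := tri (9/34) (1/34) (1/34) : 'I_3 -> R.
(* Agrees with [l] at the first index only: the cut passes through one vertex of the tetrahedron,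
   and 2 + 3 vertices result. *)
pose k := tri (9/34) (1/4) (1/2) : 'I_3 -> R.
have qE : tetra_apex e = pt (-29/32) (-1/32) (13/32).
  by rewrite /tetra_apex sum_tri /e /tri /= !ptD; congr pt; lra.
apply: (@tetra_cut_state R n e l k
  [:: pt (-5/32) (-9/32) (-11/32); pt (1/32) (-11/32) (15/32);
      pt (11/288) (263/288) (-155/288); pt (175/32) (-69/32) (-191/32);
      pt (481/32) (-171/32) (47/32)]
  [:: pt (-69) 14 17; pt (10/23) 1 (-3/23); pt (-1) (-3) 0; pt 1 4 5; pt (-2) 0 (-2)]
  (* The stable facet is the cut itself, the head of the list of normals; hence [j0] is 0 while [i0]
     is 1. *)
  (pt (481/32) (-171/32) (47/32)) (pt (-69) 14 17) (lift ord0 ord0) ord0).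
- by elim/tri_ind; elim/tri_ind; rewrite /n /e /tri /= dot_pt /=; lra.
- by elim/tri_ind; rewrite /l /tri /=; lra.
- by rewrite sum_tri /l /tri /=; lra.
- by elim/tri_ind; rewrite /l /k /tri /=; lra.
- by elim/tri_ind; elim/tri_ind; rewrite ?eqxx // /l /k /tri /=; lra.
- by rewrite sum_tri /k /tri /=; lra.
- by rewrite /l /k /tri /= gt_eqF //; lra.
- rewrite qE /codom /image_mem enum_ord3 /= /tetra_vertex qE /l /k /e /tri /= eqxx /=.
  rewrite (_ : (1 / 4 == 1 / 34 :> R) = false); last by rewrite gt_eqF //; lra.
  rewrite (_ : (1 / 2 == 1 / 34 :> R) = false) /=; last by rewrite gt_eqF //; lra.
  by repeat congr (_ :: _); pt_simpl; congr pt; field.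
- rewrite /cut_facet /tetra_base /codom /image_mem enum_ord3 /= !sum_tri /l /k /n /tri /=.
  by repeat congr (_ :: _); pt_simpl; congr pt; field.
- by apply: sole_equilibrium_all; [rewrite !inE eqxx ?orbT | sole_pt].
- by apply: sole_equilibrium_all; [rewrite !inE eqxx ?orbT | sole_pt].
- by rewrite qE /k /e /tri /=; pt_neq.
- by rewrite /n /tri /=; pt_neq.
Qed.

Lemma mono_state56 (R : realType) : mono_state R 5 6.
Proof.
pose n := tri (pt 2 (-1) (-1)) (pt (-1) (-1) 1) (pt (-5) 4 (-10)) : 'I_3 -> point R.
pose e := tri (pt (1/6) (-5/12) (-1/4)) (pt (-7/18) (-25/36) (-1/12))
  (pt (-1/18) (-1/36) (-1/12)) : 'I_3 -> point R.
pose l := tri (1/37) (34/37) (1/37) : 'I_3 -> R.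
(* Differs from [l] at every index: all three cutting points are new, and 3 + 3 vertices result. *)
pose k := tri (1/4) 1 (1/8) : 'I_3 -> R.
have qE : tetra_apex e = pt (-5/18) (-41/36) (-5/12).
  by rewrite /tetra_apex sum_tri /e /tri /= !ptD; congr pt; lra.
apply: (@tetra_cut_state R n e l k
  [:: pt (-17/18) (19/36) (7/12); pt (1/9) (-4/9) (-1/3); pt (1/6) (-11/12) (1/4);
      pt (-58/9) (257/18) (53/6); pt (89/612) (-469/1224) (-133/408);
      pt (16/9) (-1/9) (8/3)]
  [:: pt (-3) (-2) (-4/3); pt 37 31 (-23); pt 2 (-1) (-1); pt (-1) (-1) 1;
      pt (-5) 4 (-10)]
  (pt (-58/9) (257/18) (53/6)) (pt 37 31 (-23)) (lift ord0 ord0) ord0).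
- by elim/tri_ind; elim/tri_ind; rewrite /n /e /tri /= dot_pt /=; lra.
- by elim/tri_ind; rewrite /l /tri /=; lra.
- by rewrite sum_tri /l /tri /=; lra.
- by elim/tri_ind; rewrite /l /k /tri /=; lra.
- by elim/tri_ind; elim/tri_ind; rewrite ?eqxx // /l /k /tri /=; lra.
- by rewrite sum_tri /k /tri /=; lra.
- by rewrite /l /k /tri /= gt_eqF //; lra.
- rewrite qE /codom /image_mem enum_ord3 /= /tetra_vertex qE /l /k /e /tri /=.
  rewrite (_ : (1 / 4 == 1 / 37 :> R) = false); last by rewrite gt_eqF //; lra.
  rewrite (_ : (1 == 34 / 37 :> R) = false); last by rewrite gt_eqF //; lra.
  rewrite (_ : (1 / 8 == 1 / 37 :> R) = false) /=; last by rewrite gt_eqF //; lra.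
  by repeat congr (_ :: _); pt_simpl; congr pt; field.
- rewrite /cut_facet /tetra_base /codom /image_mem enum_ord3 /= !sum_tri /l /k /n /tri /=.
  by repeat congr (_ :: _); pt_simpl; congr pt; field.
- by apply: sole_equilibrium_all; [rewrite !inE eqxx ?orbT | sole_pt].
- by apply: sole_equilibrium_all; [rewrite !inE eqxx ?orbT | sole_pt].
- by rewrite qE /k /e /tri /=; pt_neq.
- by rewrite /n /tri /=; pt_neq.
Qed.

(** A step of [once] raises 2f - v by one and a step of [twice] keeps it. From (5, 5),
    [2 * f - v - 5] diagonal steps set this value and [v - f] further steps reach the pair; for the
    value 4 only [twice] helps, starting from (5, 6). *)
Lemma mono_state_exists (R : realType) f v : (f <= v)%N -> (v + 4 <= 2 * f)%N ->
  (f, v) <> (4%N, 4%N) -> mono_state R f v.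
Proof.
have twice m f' v' : mono_state R f' v' -> mono_state R (f' + m) (v' + 2 * m).
  elim: m => [|m IH] S; first by rewrite muln0 !addn0.
  by rewrite addnS mulnS addnA addnAC; apply: (mono_state_step false); apply: IH.
have once m f' : mono_state R f' f' -> mono_state R (f' + m) (f' + m).
  elim: m => [|m IH] S; first by rewrite addn0.
  by rewrite addnS -{2}addn1; apply: (mono_state_step true); apply: IH.
move=> fv v4 fv4; have [n4|n5] := leqP (2 * f - v)%N 4.
  have [v5 f5] : (v = 2 * f - 4)%N /\ (5 <= f)%N.
    have vE : (v = 2 * f - 4)%N by lia.
    split=> //; rewrite ltnNge; apply/negP => f4; apply: fv4.
    by congr (_, _); lia.
  have -> : f = (5 + (f - 5))%N by lia.
  have -> : v = (6 + 2 * (f - 5))%N by lia.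
  exact: twice (mono_state56 R).
have fE : (5 + (2 * f - v - 5) + (v - f) = f)%N by lia.
have vE : (5 + (2 * f - v - 5) + 2 * (v - f) = v)%N by lia.
have := twice (v - f)%N _ _ (once (2 * f - v - 5)%N 5 (mono_state55 R)).
by rewrite fE vE.
Qed.

(** * Faces of a polar pair *)

Section AffineIndependence.
Variable R : realType.
Implicit Types (X Y P : point R -> Prop) (x y z n m : point R).

Lemma same_set_trans X Y Z : same_set X Y -> same_set Y Z -> same_set X Z.
Proof. by move=> XY YZ x; rewrite XY. Qed.

Lemma same_set_sym X Y : same_set X Y -> same_set Y X.
Proof. by move=> XY x; rewrite XY. Qed.

Lemma has_aff_indep_same X Y k : same_set X Y -> has_aff_indep X k -> has_aff_indep Y k.
Proof. by move=> XY [p [pX rk]]; exists p; split=> // i; rewrite -XY. Qed.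

Lemma kface_same P X Y k : same_set X Y -> kface P X k -> kface P Y k.
Proof.
move=> XY [[n [c [sup Xf]]] [aX naX]]; split.
  by exists n, c; split=> // x; rewrite -XY.
split; first exact: has_aff_indep_same aX.
by move=> aY; apply: naX; apply: has_aff_indep_same (same_set_sym XY) aY.
Qed.

Lemma row_differences k (p : 'I_k.+1 -> point R) (i : 'I_k) :
  row i (\matrix_(i < k, j < 3) (p (lift ord0 i) ord0 j - p ord0 ord0 j)) =
  p (lift ord0 i) - p ord0.
Proof. by apply/rowP => j; rewrite !mxE. Qed.

Lemma has_aff_indep0 X x : X x -> has_aff_indep X 0.
Proof.
move=> Xx; exists (fun=> x); split=> //.
by apply/eqP; rewrite -leqn0 rank_leq_row.
Qed.

Lemma has_aff_indep1 X : has_aff_indep X 1 <-> exists x y, [/\ X x, X y & x <> y].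
Proof.
split=> [[p [pX rk]]|[x [y [Xx Xy xy]]]].
  exists (p ord0), (p (lift ord0 ord0)); split=> // E; move: rk.
  rewrite (_ : \matrix_(i, j) _ = 0) ?mxrank0 //; apply/row_matrixP => i.
  by rewrite row_differences (ord1 i) E subrr row0.
exists (fun i => if i == ord0 then x else y); split=> [i|]; first by case: eqP.
rewrite rank_rV (_ : _ != 0) //; apply/eqP => M0; apply: xy; apply/rowP => j.
by move/rowP/(_ j): M0; rewrite !mxE /= => /eqP; rewrite subr_eq0 => /eqP.
Qed.

(** Normals orthogonal to two independent directions are proportional, and the common level 1 fixes
    the factor. *)
Lemma has_aff_indep2_plane X n m : has_aff_indep X 2 ->
  (forall x, X x -> dot n x = 1) -> (forall x, X x -> dot m x = 1) -> n = m.
Proof.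
move=> [p [pX rk]] nX mX.
have orth a : (forall x, X x -> dot a x = 1) ->
    forall i : 'I_2, dot a (p (lift ord0 i) - p ord0) = 0.
  by move=> aX i; rewrite dotDr dotNr !aX // subrr.
have n0 : n != 0.
  by apply/eqP => E; have /eqP := nX _ (pX ord0); rewrite E dot0l eq_sym oner_eq0.
have [a E] : exists a, m = a *: n.
  by apply: (rank2_colinear rk _ _ n0) => i; rewrite row_differences orth.

have := mX _ (pX ord0); rewrite E dotZl nX // mulr1 => ->.
by rewrite scale1r.
Qed.

Lemma has_aff_indep3_plane X n : (forall x, X x -> dot n x = 1) -> ~ has_aff_indep X 3.
Proof.
move=> nX [p [pX rk]]; have n0 : n = 0.
  apply: (rank3_orthogonal rk) => i.
  by rewrite (row_differences p i) dotDr dotNr !nX // subrr.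
by have /eqP := nX _ (pX ord0); rewrite n0 dot0l eq_sym oner_eq0.
Qed.

Lemma has_aff_indep2_rows X x y z (D : 'M[R]_(2, 3)) : \rank D = 2 ->
  X x -> X y -> X z -> row 0 D = y - x -> row 1 D = z - x -> has_aff_indep X 2.
Proof.
move=> rD Xx Xy Xz D0 D1.
pose p (i : 'I_3) := if i == ord0 then x else if i == lift ord0 ord0 then y else z.
exists p; split=> [i|]; first by rewrite /p; do 2![case: ifP => _ //].
rewrite -[RHS]rD; congr (\rank _); apply/row_matrixP => i; rewrite (row_differences p i).
have [->|->] : i = 0 \/ i = 1.
- by case: i => [[|[|//]] ?]; [left|right]; apply: val_inj.
- by rewrite D0.
- by rewrite D1.
Qed.

Lemma not_has_aff_indep2 X x y z : ~ has_aff_indep X 2 -> X x -> X y -> X z ->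
  y != x -> exists a, z = x + a *: (y - x).
Proof.
move=> nX Xx Xy Xz yx; case: (boolP (z - x <= y - x)%MS) => [/sub_rVP[a E]|nsub].
  by exists a; rewrite -E addrC subrK.
case: nX; have [a b ab0|D [rD D0 D1]] := @rank2_independent R (y - x) (z - x); last first.
  exact: has_aff_indep2_rows rD Xx Xy Xz D0 D1.
have [b0|b0] := eqVneq b 0.
  move: ab0; rewrite b0 scale0r addr0 => /eqP; rewrite scaler_eq0 subr_eq0 (negPf yx) orbF.
  by move/eqP.
case/negP: nsub; apply/sub_rVP; exists (- (b^-1 * a)).
rewrite scaleNr -scalerA; apply/eqP; rewrite -addr_eq0.
by rewrite -[z - x](scalerK b0) -scalerDr addrC ab0 scaler0.
Qed.

Lemma open_halfspaces (S : seq (point R)) y : (forall n, n \in S -> dot n y < 1) ->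
  exists2 eps : R, 0 < eps & forall x, dot (x - y) (x - y) < eps ^+ 2 ->
    forall n, n \in S -> dot n x <= 1.
Proof.
elim: S => [|n S IH] lt; first by exists 1.
have [|e1 e1_gt0 h1] := IH; first by move=> m mS; apply: lt; rewrite inE mS orbT.
have c0 : 0 < 1 - dot n y by rewrite subr_gt0 lt ?mem_head.
set c := 1 - dot n y in c0.
have d0 : 0 < 1 + dot n n by have := dot_ge0 n; lra.
(* The number [1 + dot n n] exceeds the length of [n] without a square root and is never 0;
   Cauchy-Schwarz does the rest. *)
pose e2 := c / (1 + dot n n); have e2_gt0 : 0 < e2 by rewrite divr_gt0.
exists (Num.min e1 e2); first by rewrite lt_min e1_gt0.
move=> x xy; have le e : 0 < e -> Num.min e1 e2 <= e -> dot (x - y) (x - y) < e ^+ 2.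
  move=> e0 le; apply: lt_le_trans xy _; rewrite lerXn2r ?nnegrE ?(ltW e0) //.
  by rewrite le_min !ltW.
move=> m; rewrite inE => /predU1P[->|]; last by apply: h1; rewrite le ?ge_min ?lexx.
have xy2 : dot (x - y) (x - y) < e2 ^+ 2 by rewrite le ?ge_min ?lexx ?orbT.
have nxy : dot n (x - y) ^+ 2 <= c ^+ 2.
  apply: le_trans (dot_CS _ _) _.
  have e2E : e2 * (1 + dot n n) = c by rewrite divfK // gt_eqF.
  have nn := dot_ge0 n; have := dot_ge0 (x - y).
  move: (dot (x - y) _) xy2 => a a2 a0.
  rewrite -e2E; apply: (@le_trans _ _ (dot n n * e2 ^+ 2)).
    by rewrite ler_wpM2l // ltW.
  have -> : (e2 * (1 + dot n n)) ^+ 2 = e2 ^+ 2 * (1 + dot n n) ^+ 2 by ring.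
  have := sqr_ge0 e2; move: (e2 ^+ 2) (dot n n) nn => E b b0 E0.
  have : 0 <= E * (1 + b + b * b) by rewrite mulr_ge0 //; nra.
  lra.
have : dot n (x - y) <= c.
  by apply: le_trans (ler_norm _) _; rewrite -(ger0_norm (ltW c0)) -ler_sqr ?real_normK
     ?num_real ?nnegrE // !real_normK ?num_real.
by rewrite dotDr dotNr /c; lra.
Qed.

Lemma small_multiple (eps : R) x : 0 < eps ->
  exists2 t : R, 0 < t & forall s : R, 0 <= s -> s <= t -> dot (s *: x) (s *: x) < eps ^+ 2.
Proof.
move=> e0; have d0 : 0 < 1 + dot x x by have := dot_ge0 x; lra.
exists (eps / (1 + dot x x)); first exact: divr_gt0.
move=> s s0; rewrite ler_pdivlMr // => st; rewrite dotZl dotZr.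
have x0 := dot_ge0 x; move: (dot x x) x0 st d0 => a a0 st d0.
have s2 : (s * (1 + a)) ^+ 2 <= eps ^+ 2.
  by rewrite lerXn2r // ?nnegrE ?mulr_ge0 // ltW.
have [s00|s00] := eqVneq s 0; first by rewrite s00 mul0r exprn_gt0.
have sp : 0 < s by rewrite lt0r s00.
apply: lt_le_trans s2; rewrite expr2.
have : 0 < s * s * (1 + a + a * a) by rewrite !mulr_gt0 //; nra.
lra.
Qed.

End AffineIndependence.

Section Faces.
Variables (R : realType) (V N : seq (point R)).
Hypothesis VN : polar V N.
Implicit Types (X Y : point R -> Prop) (x y z v w n m : point R).

Local Notation P := (hull V).

Definition face_of m : point R -> Prop := fun x => P x /\ dot m x = 1.

Lemma polar_dot_le n x : hull N n -> P x -> dot n x <= 1.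
Proof.
move=> nN xP; rewrite dotC; apply: hull_dot_le nN => m mN; rewrite dotC.
exact: (polar_ballP VN x).1.
Qed.

Lemma polar_origin : P 0.
Proof. by apply/(polar_ballP VN) => n _; rewrite dot0r. Qed.

Lemma polar_interior : interior P 0.
Proof.
have [|eps e0 h] := @open_halfspaces R N 0; first by move=> n _; rewrite dot0r.
by exists eps; split=> // x xe; apply/(polar_ballP VN); apply: h.
Qed.

Lemma polar_extreme v y z t : v \in V -> P y -> P z -> 0 < t -> t < 1 ->
  v = (1 - t) *: y + t *: z -> y = v.
Proof.
move=> vV yP zP t0 t1 e; apply: (polar_exposed VN vV yP) => n nN.
rewrite {1}e !dotlin; have := (polar_ballP VN y).1 yP n nN.
have := (polar_ballP VN z).1 zP n nN.
by move: (dot n y) (dot n z) => a b; nra.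
Qed.

(** The origin is interior, so a supporting plane misses it and can be scaled to level 1 with the
    body below; polarity then puts the normal into [hull N]. *)
Lemma face_normal X : is_face P X ->
  exists m, [/\ hull N m, exists x, X x & same_set X (face_of m)].
Proof.
move=> [n [c [[n0 [bound [x0 [x0P nx0]]]] XE]]].
suff [c0 le] : c != 0 /\ forall x, P x -> dot (c^-1 *: n) x <= 1.
  exists (c^-1 *: n); split.
  - by apply: (polar_hullN VN) => v vV; apply: le; apply: hull_in.
  - by exists x0; apply/XE.
  - move=> x; rewrite XE /face_of dotZl; split=> -[xP nx]; split=> //.
      by rewrite nx mulVf.
    by rewrite -[LHS](mulVKf c0) nx mulr1.
have [eps [e0 ball]] := polar_interior.
have [t t0 small] := small_multiple n e0.
(* A small multiple of [n] and its opposite lie in the body; they fix the sign of [c] for support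
   from above and from below. *)
have tP : P (t *: n) by apply: ball; rewrite subr0; apply: small; rewrite ?lexx ?ltW.
have ntP : P (- (t *: n)).
  by apply: ball; rewrite subr0 dotNl dotNr opprK; apply: small; rewrite ?lexx ?ltW.
have tn : 0 < t * dot n n by rewrite mulr_gt0 // dot_gt0.
case: bound => le.
  have c0 : 0 < c by apply: lt_le_trans tn _; have := le _ tP; rewrite dotZr.
  split=> [|x xP]; first by rewrite gt_eqF.
  by rewrite dotZl mulrC ler_pdivrMr // mul1r le.
have c0 : c < 0 by have := le _ ntP; rewrite dotNr dotZr; lra.
split=> [|x xP]; first by rewrite lt_eqF.
by rewrite dotZl mulrC ler_ndivrMr // mul1r le.
Qed.

Lemma is_face_of m : hull N m -> (exists x, face_of m x) -> is_face P (face_of m).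
Proof.
move=> mN [x mx]; exists m, 1; split=> //; split; last split.
- by apply/eqP => E; case: mx => _ /eqP; rewrite E dot0l eq_sym oner_eq0.
- by left=> y yP; apply: polar_dot_le.
- by exists x.
Qed.

Lemma face_has_vertex m x : hull N m -> face_of m x -> exists2 v, v \in V & dot m v = 1.
Proof.
move=> mN [xP mx]; case: (polar_two_vertices VN xP) => [xV|]; first by exists x.
by move=> [v [w [vV _ _ tight]]]; exists v => //; case: (tight m mN mx).
Qed.

(** Averages normals tight at [v], one for each other vertex: a mixture is strict wherever one of
    its parts is. *)
Lemma vertex_normal v : v \in V ->
  exists m, [/\ hull N m, dot m v = 1 & forall w, w \in V -> w <> v -> dot m w < 1].
Proof.
move=> vV; suff H (s : seq (point R)) : {subset s <= V} -> exists m,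
    [/\ hull N m, dot m v = 1 & forall w, w \in s -> w <> v -> dot m w < 1].
  by apply: H.
elim: s => [_|w s IH sV].
  by have [n nN nv] := polar_tight VN vV; exists n; split=> //; apply: hull_in.
have [|m [mN mv mlt]] := IH; first by move=> z zs; apply: sV; rewrite inE zs orbT.
have wV : w \in V by apply: sV; rewrite mem_head.
have [wv|/eqP wv] := eqVneq w v.
  by exists m; split=> // z; rewrite inE => /predU1P[->|/mlt].
have [n nN [nv nw]] := polar_extV VN vV wV (nesym wv).
exists ((1 - 2^-1) *: m + 2^-1 *: n); split.
- by apply: hull_mix; rewrite ?invr_gt0 ?invf_lt1 ?ltr1n //; apply: hull_in.
- by rewrite !dotlin mv nv; lra.
- move=> z zws zv; have zV := sV z zws; have nz : dot n z <= 1 by apply: (polar_le VN).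
  have mz : dot m z <= 1 by apply: polar_dot_le => //; apply: hull_in.
  rewrite !dotlin; move: zws; rewrite inE => /predU1P[zw|zs].
    by move: nz mz; rewrite zw; lra.
  by have := mlt z zs zv; lra.
Qed.

Lemma face_of_vertex v m : v \in V -> hull N m -> dot m v = 1 ->
  (forall w, w \in V -> w <> v -> dot m w < 1) -> same_set (face_of m) (eq^~ v).
Proof.
move=> vV mN mv mlt x; split=> [[xP mx]|->]; last by split=> //; apply: hull_in.
have only w : w \in V -> dot m w = 1 -> w = v.
  move=> wV mw; have [//|/eqP wv] := eqVneq w v.
  by have := mlt w wV wv; rewrite mw ltxx.
case: (polar_two_vertices VN xP) => [xV|[w [z [wV zV wz tight]]]]; first exact: only.
by case: (tight m mN mx) => mw mz; case: wz; rewrite (only w) // (only z).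
Qed.

Lemma kface0_vertex v : v \in V -> kface P (eq^~ v) 0.
Proof.
move=> vV; have [m [mN mv mlt]] := vertex_normal vV.
apply: (kface_same (face_of_vertex vV mN mv mlt)); split.
  by apply: is_face_of => //; exists v; split=> //; apply: hull_in.
split; first by apply: (has_aff_indep0 (x := v)); split=> //; apply: hull_in.
move=> /has_aff_indep1[x [y []]].
by move=> /(face_of_vertex vV mN mv mlt) -> /(face_of_vertex vV mN mv mlt) ->.
Qed.

Lemma kface0P X : kface P X 0 -> exists2 v, v \in V & same_set X (eq^~ v).
Proof.
move=> [/face_normal[m [mN [x Xx] XE]] [_ nX]].
have [v vV mv] := face_has_vertex mN ((XE x).1 Xx).
have Xv : X v by apply/XE; split=> //; apply: hull_in.
exists v => // y; split=> [Xy|->//].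
have [//|/eqP yv] := eqVneq y v.
by case: nX; apply/has_aff_indep1; exists y, v.
Qed.

(** Dual averaging: a mixture of vertices of the facet is strict for all other normals, which leaves
    room for a small disk in the plane of the facet. *)
Lemma facet_relint n : n \in N -> exists y (eps : R),
  [/\ 0 < eps, P y, dot n y = 1 & forall d, dot n d = 0 -> dot d d < eps ^+ 2 -> P (y + d)].
Proof.
move=> nN.
have [y [yP ny ylt]] : exists y, [/\ P y, dot n y = 1 &
    forall m, m \in N -> m <> n -> dot m y < 1].
  suff H (s : seq (point R)) : {subset s <= N} -> exists y, [/\ P y, dot n y = 1 &
      forall m, m \in s -> m <> n -> dot m y < 1] by apply: H.
  elim: s => [_|m s IH sN].
    have [v vV vn] := polar_tight (polarC VN) nN.
    by exists v; split=> //; [apply: hull_in | rewrite dotC].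
  have [|y [yP ny ylt]] := IH; first by move=> z zs; apply: sN; rewrite inE zs orbT.
  have mN : m \in N by apply: sN; rewrite mem_head.
  have [mn|/eqP mn] := eqVneq m n.
    by exists y; split=> // z; rewrite inE => /predU1P[->|/ylt].
  have [v vV [nv mv]] := polar_extN VN nN mN (nesym mn).
  exists ((1 - 2^-1) *: y + 2^-1 *: v); split.
  - by apply: hull_mix; rewrite ?invr_gt0 ?invf_lt1 ?ltr1n //; apply: hull_in.
  - by rewrite !dotlin ny nv; lra.
  - move=> z zms zn; have zN := sN z zms; have zv : dot z v <= 1 by apply: (polar_le VN).
    have zy : dot z y <= 1 by apply: (polar_ballP VN y).1.
    rewrite !dotlin; move: zms; rewrite inE => /predU1P[zm|zs].
      by move: zv zy; rewrite zm; lra.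
    by have := ylt z zs zn; lra.
have [|eps e0 ball] := @open_halfspaces R [seq m <- N | m != n] y.
  by move=> m; rewrite mem_filter => /andP[/eqP mn mN]; apply: ylt.
exists y, eps; split=> // d nd dd; apply/(polar_ballP VN) => m mN.
have [->|mn] := eqVneq m n; first by rewrite dotDr ny nd addr0.
by apply: ball; rewrite ?mem_filter ?mn // addrAC subrr add0r.
Qed.

Lemma kface2_facet n : n \in N -> kface P (face_of n) 2.
Proof.
move=> nN; have [y [eps [e0 yP ny ball]]] := facet_relint nN.
have n0 : n != 0 by apply/eqP => E; move/eqP: ny; rewrite E dot0l eq_sym oner_eq0.
have [D [rD nD]] := exists_orthogonal_plane n0.
have [t0 t0_gt0 small0] := small_multiple (row 0 D) e0.
have [t1 t1_gt0 small1] := small_multiple (row 1 D) e0.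
pose t := Num.min t0 t1; have t_gt0 : 0 < t by rewrite lt_min t0_gt0.
split; first by apply: is_face_of; [exact: hull_in | exists y].
split; last by apply: (@has_aff_indep3_plane _ _ n) => x [].
have inF i : dot (t *: row i D) (t *: row i D) < eps ^+ 2 -> face_of n (y + t *: row i D).
  move=> small; split; last by rewrite dotDr dotZr nD ny mulr0 addr0.
  by apply: ball; rewrite // dotZr nD mulr0.
apply: (has_aff_indep2_rows (x := y) (y := y + t *: row 0 D) (z := y + t *: row 1 D)
  (D := t *: D)).
- by rewrite mxrank_scale_nz // gt_eqF.
- by split.
- by apply: inF; apply: small0; rewrite ?ge_min ?lexx // ltW.
- by apply: inF; apply: small1; rewrite ?ge_min ?lexx ?orbT // ltW.
- by rewrite addrAC subrr add0r; apply/rowP => j; rewrite !mxE.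
- by rewrite addrAC subrr add0r; apply/rowP => j; rewrite !mxE.
Qed.

Lemma normal_cases m : hull N m -> m \in N \/
  exists n n', [/\ n \in N, n' \in N, n <> n' &
    forall x, face_of m x -> dot n x = 1 /\ dot n' x = 1].
Proof.
move=> /(polar_two_vertices (polarC VN))[|[n [n' [nN n'N nn' tight]]]]; first by left.
right; exists n, n'; split=> // x [xP mx].
by rewrite -!(dotC x); apply: tight; rewrite // dotC.
Qed.

Lemma kface2P X : kface P X 2 -> exists2 n, n \in N & same_set X (face_of n).
Proof.
move=> [/face_normal[m [mN _ XE]] [aX _]].
case: (normal_cases mN) => [mN'|[n [n' [_ _ nn' tight]]]]; first by exists m.
by case: nn'; apply: (has_aff_indep2_plane aX) => x /XE /tight[].
Qed.

Lemma face_of_inj n n' : n \in N -> n' \in N -> same_set (face_of n) (face_of n') -> n = n'.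
Proof.
move=> nN n'N E; have [_ [aX _]] := kface2_facet nN.
by apply: (has_aff_indep2_plane aX) => x; [case | move=> /E []].
Qed.

(** Dimension one puts the face on the line through [v] and [w]; a point beyond either end would
    place that vertex inside a segment of the body. *)
Lemma kface1_segment X v w : kface P X 1 -> v \in V -> w \in V -> v != w ->
  X v -> X w -> same_set X (hull [:: v; w]).
Proof.
move=> [/face_normal[m [mN _ XE]] [_ nX]] vV wV vw Xv Xw.
have subP x : hull [:: v; w] x -> P x.
  by apply: hull_subset => z; rewrite !inE => /orP[]/eqP ->.
have [_ mv] := (XE v).1 Xv; have [_ mw] := (XE w).1 Xw.
move=> x; split=> [Xx|xvw]; last first.
  apply/XE; split; first exact: subP.
  elim: xvw => [z|t y z t0 t1 _ my _ mz]; first by rewrite !inE => /orP[]/eqP ->.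
  by rewrite !dotlin my mz; lra.
have wv : w != v by rewrite eq_sym.
have [a xE] := not_has_aff_indep2 nX Xv Xw Xx wv.
have [xP _] := (XE x).1 Xx; have vP := hull_in vV; have wP := hull_in wV.
have [a0|a0] := ltrP a 0.
  have a1 : 1 - a != 0 by apply/eqP; lra.
  have vE : v = (1 - (- a / (1 - a))) *: x + (- a / (1 - a)) *: w.
    by rewrite xE; apply/rowP => j; rewrite !mxE; field.
  (* The same mixture with its parts exchanged, since [polar_extreme] identifies the first part with
     the vertex. *)
  have wE : v = (1 - (1 - (- a / (1 - a)))) *: w + (1 - (- a / (1 - a))) *: x.
    by rewrite subKr addrC -vE.
  have s0 : 0 < - a / (1 - a) by rewrite divr_gt0; lra.
  have s1 : - a / (1 - a) < 1 by rewrite ltr_pdivrMr; lra.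
  have := polar_extreme vV wP xP _ _ wE; rewrite subr_gt0 s1 gtrDl oppr_lt0 s0.
  by move=> /(_ isT isT) E; rewrite E eqxx in wv.
have [a1|a1] := ltrP 1 a.
  have an0 : a != 0 by apply/eqP; lra.
  have wE : w = (1 - a^-1) *: v + a^-1 *: x.
    by rewrite xE; apply/rowP => j; rewrite !mxE; field.
  have E : v = w.
    by apply: (polar_extreme wV vP xP _ _ wE); rewrite ?invr_gt0 ?invf_lt1 //; lra.
  by rewrite E eqxx in vw.
have -> : x = (1 - a) *: v + a *: w.
  by rewrite xE; apply/rowP => j; rewrite !mxE; ring.
by apply: hull_convex => //; apply: hull_in; rewrite !inE eqxx ?orbT.
Qed.

Lemma kface1_edge v w : v \in V -> w \in V -> adj N v w -> kface P (hull [:: v; w]) 1.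
Proof.
move=> vV wV /(adjP _ _ (polar_uniqN VN)).
move=> [vw [n [n' [nN n'N nn' /andP[/eqP nv /eqP nw] /andP[/eqP n'v /eqP n'w]]]]].
(* This functional is tight at a point of the body exactly when [n] and [n'] both are, so its face
   is the intersection of the two facets. *)
pose m := (1 - 2^-1) *: n + 2^-1 *: n'.
have mN : hull N m.
  by apply: hull_mix; rewrite ?invr_gt0 ?invf_lt1 ?ltr1n //; apply: hull_in.
have tight x : face_of m x -> dot n x = 1 /\ dot n' x = 1.
  move=> [xP]; have nx := (polar_ballP VN x).1 xP n nN.
  have := (polar_ballP VN x).1 xP n' n'N.
  by rewrite /m dotDl !dotZl; split; lra.
have mvw x : x \in [:: v; w] -> face_of m x.
  rewrite !inE => /orP[]/eqP ->; (split; first exact: hull_in); rewrite /m dotDl !dotZl.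
    by rewrite nv n'v; lra.
  by rewrite nw n'w; lra.
have K : kface P (face_of m) 1.
  split; first by apply: is_face_of => //; exists v; apply: mvw; rewrite mem_head.
  split.
    apply/has_aff_indep1; exists v, w; split; [| |exact/eqP];
      by apply: mvw; rewrite !inE eqxx ?orbT.
  move=> a2; move/eqP: nn'; apply.
  by apply: (has_aff_indep2_plane a2) => x /tight[].
have mv : face_of m v by apply: mvw; rewrite mem_head.
have mw : face_of m w by apply: mvw; rewrite !inE eqxx orbT.
exact: kface_same (kface1_segment K vV wV vw mv mw) K.
Qed.

(** The midpoint of two distinct points of the face is no vertex, hence supplies two vertices of the
    face. The normal is no facet normal, as the dimension would be two, so the face lies in two
    facets. *)
Lemma kface1P X : kface P X 1 ->
  exists v w, [/\ v \in V, w \in V, adj N v w & same_set X (hull [:: v; w])].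
Proof.
move=> K; have [/face_normal[m [mN _ XE]] [/has_aff_indep1[x [y [Xx Xy xy]]] nX]] := K.
have [xP mx] := (XE x).1 Xx; have [yP my] := (XE y).1 Xy.
pose z := (1 - 2^-1) *: x + 2^-1 *: y.
have half : 0 < 2^-1 :> R /\ 2^-1 < 1 :> R by rewrite invr_gt0 invf_lt1 ?ltr1n.
have zP : P z by case: half => ? ?; apply: hull_mix.
have mz : dot m z = 1 by rewrite /z !dotlin mx my; lra.
have [zV|[v [w [vV wV vw tight]]]] := polar_two_vertices VN zP.
  case: half => h0 h1; have xz := polar_extreme zV xP yP h0 h1 erefl.
  have yz : y = z.
    by apply: (polar_extreme zV yP xP h0 h1); apply/rowP => j; rewrite !mxE; lra.
  by case: xy; rewrite xz -yz.
have [mv mw] := tight m mN mz.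
have Xv : X v by apply/XE; split=> //; apply: hull_in.
have Xw : X w by apply/XE; split=> //; apply: hull_in.
exists v, w; split=> //; last by apply: kface1_segment => //; apply/eqP.
case: (normal_cases mN) => [mN'|[n [n' [nN n'N nn' tight']]]].
  case: nX; have [_ [a2 _]] := kface2_facet mN'.
  exact: has_aff_indep_same (same_set_sym XE) a2.
apply/(adjP _ _ (polar_uniqN VN)); split; first exact/eqP.
have [nv n'v] := tight' v ((XE v).1 Xv); have [nw n'w] := tight' w ((XE w).1 Xw).
by exists n, n'; rewrite /common nv n'v nw n'w eqxx; split=> //; apply/eqP.
Qed.

Lemma num_kfaces_seq (T : eqType) (s : seq T) (t0 : T) (F : T -> point R -> Prop) k :
  uniq s -> (forall t, t \in s -> kface P (F t) k) ->
  (forall t t', t \in s -> t' \in s -> same_set (F t) (F t') -> t = t') ->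
  (forall X, kface P X k -> exists2 t, t \in s & same_set X (F t)) ->
  num_kfaces P k (size s).
Proof.
move=> us Fk Finj Fall; exists (fun i : 'I_(size s) => F (nth t0 s i)); split; last split.
- by move=> i; apply: Fk; apply: mem_nth.
- move=> i j S; apply: val_inj; apply/eqP; rewrite -(nth_uniq t0 (ltn_ord i) (ltn_ord j) us).
  by apply/eqP; apply: Finj S; apply: mem_nth.
- move=> X /Fall[t ts XE]; have its : (index t s < size s)%N by rewrite index_mem.
  by exists (Ordinal its); rewrite /= nth_index.
Qed.

Lemma num_vertices : num_kfaces P 0 (size V).
Proof.
apply: (num_kfaces_seq 0 (F := fun v x => x = v)) => [||v w _ _ E|].
- exact: polar_uniqV VN.
- exact: kface0_vertex.
- exact: (E v).1.
- exact: kface0P.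
Qed.

Lemma num_facets : num_kfaces P 2 (size N).
Proof.
apply: (num_kfaces_seq 0 (F := face_of)).
- exact: polar_uniqN VN.
- exact: kface2_facet.
- exact: face_of_inj.
- exact: kface2P.
Qed.

(** Each edge occurs once, oriented by the positions of its ends in [V], whereas [darts] counts both
    orientations. *)
Definition edge_pairs := [seq p <- [seq (v, w) | v <- V, w <- V] |
  (index p.1 V < index p.2 V)%N && adj N p.1 p.2].

Lemma size_edge_pairs : (2 * size edge_pairs = darts V N)%N.
Proof.
have -> : size edge_pairs = (\sum_(v <- V) \sum_(w <- V)
    ((index v V < index w V)%N && adj N v w))%N.
  rewrite size_filter -sum1_count big_mkcond big_allpairs /=.
  by apply: eq_bigr => v _; apply: eq_bigr => w _; case: (_ && _).
rewrite mul2n -addnn {2}exchange_big -big_split; apply: eq_big_seq => v vV /=.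
rewrite -big_split; apply: eq_big_seq => w wV /=.
rewrite [adj N w v]adjC; have [vw|wv|E] := ltngtP (index v V) (index w V).
- by rewrite addn0.
- by rewrite add0n.
- by rewrite -(nth_index 0 vV) E nth_index // /adj eqxx.
Qed.

Lemma num_edges : num_kfaces P 1 (size edge_pairs).
Proof.
have mem_pair v w : ((v, w) \in edge_pairs) =
    (v \in V) && (w \in V) && ((index v V < index w V)%N && adj N v w).
  rewrite mem_filter /= andbC; congr (_ && _).
  by apply/allpairsP/andP => [[[x y] [/= xV yV [-> ->]]]|[vV wV]] //; exists (v, w).
apply: (num_kfaces_seq (0, 0) (F := fun p => hull [:: p.1; p.2])).
- rewrite filter_uniq // allpairs_uniq ?(polar_uniqV VN) //.
  by move=> [v w] [v' w'] _ _.
- by move=> [v w]; rewrite mem_pair => /andP[/andP[? ?] /andP[_ ?]]; apply: kface1_edge.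
- move=> [v w] [v' w']; rewrite !mem_pair.
  move=> /andP[/andP[vV wV] /andP[vw _]] /andP[/andP[v'V w'V] /andP[v'w' _]] E.
  have inE' x : x \in V -> hull [:: v; w] x -> x = v \/ x = w.
    move=> xV /(polar_hull_vertex VN xV); rewrite !inE.
    by case/(_ _)/orP => [z|/eqP|/eqP]; [rewrite !inE => /orP[]/eqP ->|left|right].
  have v'P : v' = v \/ v' = w.
    by apply: inE' => //; apply/E; apply: hull_in; rewrite mem_head.
  have w'P : w' = v \/ w' = w.
    by apply: inE' => //; apply/E; apply: hull_in; rewrite !inE eqxx orbT.
  case: v'P; case: w'P.
  + by move=> w'v v'v; move: v'w'; rewrite /= w'v v'v ltnn.
  + by move=> -> ->.
  + by move=> w'v v'w; move: v'w'; rewrite /= w'v v'w ltnNge ltnW.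
  + by move=> w'w v'w; move: v'w'; rewrite /= w'w v'w ltnn.
- move=> X /kface1P[v [w [vV wV vw XE]]].
  have [lt|gt|E] := ltngtP (index v V) (index w V).
  + by exists (v, w); rewrite // mem_pair vV wV lt.
  + exists (w, v); first by rewrite mem_pair vV wV gt adjC.
    apply: same_set_trans XE _ => x.
    by split; apply: hull_subset => z; rewrite !inE orbC.
  + by move: vw; rewrite -(nth_index 0 vV) E nth_index // /adj eqxx.
Qed.

End Faces.

(** * Equilibria of a polar pair *)

Section Equilibria.
Variables (R : realType) (V N : seq (point R)).
Hypothesis VN : polar V N.
Implicit Types (X Y : point R -> Prop) (x y z v w n m : point R).

Local Notation P := (hull V).

(** The origin belongs to the body, so support from below would give [dot Q Q <= 0]. *)
Lemma equilibrium_onP X : equilibrium_on P 0 X -> exists Q,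
  [/\ relint X Q, Q != 0 & forall x, P x -> dot Q x <= dot Q Q].
Proof.
move=> [Q [rel]]; rewrite subr0 => -[Q0 [[le|ge] _]]; exists Q; split=> //.
have := ge 0 (polar_origin VN); rewrite dot0r => le0 x _.
by move: Q0; rewrite -dot_gt0 ltNge le0.
Qed.

Lemma polar_neq0 n : n \in N -> n != 0.
Proof.
move=> nN; have [v _ nv] := polar_tight (polarC VN) nN.
by apply: contra_eq_neq nv => ->; rewrite dot0r eq_sym oner_neq0.
Qed.

(** Foot of the perpendicular from the origin to the plane of the facet [n]. *)
Let foot n := (dot n n)^-1 *: n.

Let dot_foot n : n \in N -> dot n (foot n) = 1.
Proof. by move=> nN; rewrite dotZr mulVf // dot_eq0 polar_neq0. Qed.

(** The foot on [ns] is strict for all other facets, hence relatively interior. On another facet the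
    touching point would again be the foot, which violates the inequality of the witness [w]. *)
Lemma unique_stable ns : sole_equilibrium N ns -> unique_equilibrium_kface P 0 2.
Proof.
move=> [nsN nslt nsw]; exists (face_of V ns); split; first exact: (kface2_facet VN).
have nn0 : 0 < dot ns ns by rewrite dot_gt0 polar_neq0.
have Qlt m : m \in N -> m != ns -> dot m (foot ns) < 1.
  by move=> mN mns; rewrite dotZr mulrC ltr_pdivrMr // mul1r nslt.
have Qns := dot_foot nsN.
have QP : P (foot ns).
  apply/(polar_ballP VN) => m mN; have [->|mns] := eqVneq m ns; first by rewrite Qns lexx.
  exact: ltW (Qlt m mN mns).
split.
  exists (foot ns); split.
    split; first by split.
    have [|eps e0 ball] := @open_halfspaces R [seq m <- N | m != ns] (foot ns).
      by move=> m; rewrite mem_filter => /andP[mns mN]; apply: Qlt.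
    exists eps; split=> // y [k [p [w [pX [w1 yE]]]]] ye.
    have nsy : dot ns y = 1.
      rewrite yE dot_sumr -w1; apply: eq_bigr => i _.
      by rewrite dotZr (pX i).2 mulr1.
    split=> //; apply/(polar_ballP VN) => m mN.
    have [->|mns] := eqVneq m ns; first by rewrite nsy lexx.
    by apply: ball ye _ _; rewrite mem_filter mns.
  rewrite subr0; split; first by rewrite scaler_eq0 invr_eq0 gt_eqF // polar_neq0.
  split; last by exists (foot ns).
  left=> x xP; rewrite ![dot (foot ns) _]dotZl Qns ler_wpM2l ?invr_ge0 ?(ltW nn0) //.
  exact: (polar_ballP VN x).1.
move=> Y KY /equilibrium_onP[Q [[YQ [eps [e0 rel]]] Q0 Qmax]].
have [n nN YE] := kface2P VN KY.
have [n_ns|n_ns] := eqVneq n ns; first by rewrite -n_ns.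
exfalso; have [w wN nw] := nsw n nN n_ns.
have [QinP nQ] := (YE Q).1 YQ.
pose r := Q - foot n; have nr : dot n r = 0.
  by rewrite /r dotDr dotNr nQ dot_foot // subrr.
have rE : Q = foot n + r by rewrite /r addrC subrK.
have Qr : dot Q r = dot r r.
  by rewrite {1}rE dotDl dotZl nr mulr0 add0r.
clearbody r.
have [y [eps' [e'0 yP ny ball]]] := facet_relint VN nN.
have [s s0 small_s] := small_multiple r e'0.
have [t t0 small_t] := small_multiple r e0.
have ysP : P (y + s *: r) by apply: ball; [rewrite dotZr nr mulr0 | apply: small_s; rewrite ?lexx ?ltW].
(* The shift is a multiple of the difference of two points of the facet, so the new point is in the
   affine hull and, [t] being small, in the facet. *)
have YQr : Y (Q + t *: r).
  apply: rel; last by rewrite addrAC subrr add0r; apply: small_t; rewrite ?lexx ?ltW.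
  exists 3%N, (tri Q (y + s *: r) y), (tri 1 (t / s) (- (t / s))); split.
    elim/tri_ind; apply/YE; rewrite /tri /=; split=> //.
    by rewrite dotDr ny dotZr nr mulr0 addr0.
  rewrite !sum_tri /tri /=; split; first by rewrite addrK.
  rewrite scale1r scalerDr scalerA divfK ?gt_eqF // scaleNr -!addrA; congr (_ + _).
  by rewrite addrCA addrN addr0.
(* Moving by [t *: r] raises [dot Q] by [t * dot r r], against maximality unless [r] vanishes. *)
have := Qmax _ ((YE _).1 YQr).1; rewrite dotDr dotZr Qr gerDl => tr.
have r0 : r = 0.
  apply/eqP; rewrite -dot_eq0; have := dot_ge0 r; move: tr; rewrite pmulr_rle0 // => a b.
  by rewrite eq_le a b.
have : dot w Q <= 1 by apply: (polar_ballP VN Q).1.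
rewrite rE r0 addr0.
have n0 : 0 < dot n n by rewrite dot_gt0 polar_neq0.
by rewrite dotZr mulrC ler_pdivrMr // mul1r leNgt dotC nw.
Qed.

Lemma unique_unstable vs : sole_equilibrium V vs -> unique_equilibrium_kface P 0 0.
Proof.
move=> [vsV vslt vsw]; exists (eq^~ vs); split; first exact: (kface0_vertex VN).
split.
  exists vs; split.
    split=> //; exists 1; split=> // y [k [p [w [pX [w1 ->]]]]] _.
    by rewrite -[RHS]scale1r -w1 scaler_suml; apply: eq_bigr => i _; rewrite pX.
  rewrite subr0; split.
    have [n _ nvs] := polar_tight VN vsV.
    by apply: contra_eq_neq nvs => ->; rewrite dot0r eq_sym oner_neq0.
  split; last by exists vs; split=> //; apply: hull_in.
  left=> x; apply: hull_dot_le => y yV; have [->//|yvs] := eqVneq y vs.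
  by rewrite dotC ltW // vslt.
move=> Y KY /equilibrium_onP[Q [[YQ _] _ Qmax]].
have [v vV YE] := kface0P VN KY.
have [<-//|v_vs] := eqVneq v vs.
have [w wV vw] := vsw v vV v_vs.
by have := Qmax w (hull_in wV); rewrite ((YE Q).1 YQ) leNgt vw.
Qed.

Lemma polar_mono_monostatic vs ns : sole_equilibrium V vs -> sole_equilibrium N ns ->
  mono_monostatic P 0.
Proof. by move=> Vs Ns; split; [apply: unique_stable Ns | apply: unique_unstable Vs]. Qed.

Lemma polar_convex_polyhedron : convex_polyhedron P.
Proof.
split; first by exists V => x; apply: hullP.
by exists 0; apply: polar_interior VN.
Qed.

End Equilibria.

Theorem theorem1p11 (R : realType) (f e v : nat) :
  (v + 4 <= 2 * f)%N -> (f + 4 <= 2 * v)%N -> e = (f + v - 2)%N ->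
  (f, e, v) <> (4%N, 6%N, 4%N) ->
  exists (P : point R -> Prop) (O : point R),
    convex_polyhedron P /\
    num_kfaces P 2 f /\ num_kfaces P 1 e /\ num_kfaces P 0 v /\
    interior P O /\ mono_monostatic P O.
Proof.
move=> v4 f4 eE not4.
suff [V [N [vs [ns [VN sN sV [dVN Vs Ns]]]]]] : exists V N vs ns, [/\ polar V N, size N = f,
    size V = v & [/\ (darts V N + 4 = 2 * (f + v))%N, sole_equilibrium V vs &
    sole_equilibrium (R := R) N ns]].
  (* Twice the number of edges is [darts V N], that is 2 (f + v) - 4. *)
  have sE : size (edge_pairs V N) = e by have := size_edge_pairs V N; lia.
  exists (hull V), 0; split; first exact: polar_convex_polyhedron VN.
  rewrite -sN -sV -sE; split; first exact: num_facets VN.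
  split; first exact: num_edges VN.
  split; first exact: num_vertices VN.
  split; first exact: polar_interior VN.
  exact: polar_mono_monostatic Vs Ns.
have not44 : (f, v) <> (4%N, 4%N) by move=> [f_4 v_4]; apply: not4; rewrite eE f_4 v_4.
have [fv|/ltnW vf] := leqP f v.
  have [V [N [q [vs [ns [n [u [i0 [[VN sN sV dVN] [Vs Ns _ _ _]]]]]]]]]] :=
    mono_state_exists R fv v4 not44.
  by exists V, N, vs, ns.
have not44' : (v, f) <> (4%N, 4%N) by move=> [v_4 f_4]; apply: not44; rewrite f_4 v_4.
have [V [N [q [vs [ns [n [u [i0 [[VN sN sV dVN] [Vs Ns _ _ _]]]]]]]]]] :=
  mono_state_exists R vf f4 not44'.
exists N, V, ns, vs; split=> //; first exact: polarC.
by split=> //; rewrite -(darts_polarC VN) dVN [(v + f)%N]addnC.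
Qed.
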